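(* Let $G=(V,E)$ be a finite, simple, connected graph. The following are equivalent: (i) $G$ is effective Bonnet Myers sharp, i.e. $K:=\min_{x\sim y}\kappa(x,y)>0$ and $\operatorname{diam}_{\operatorname{eff}}(G)=\frac{\max_{v}\operatorname{Deg}(v)}{K}$; (ii) $G$ is reflective and has constant Ollivier curvature (i.e. $\kappa(x,y)$ is the same for all edges $x\sim y$); (iii) $G$ is one of the following: a cocktail party graph, a Johnson graph, a halved cube, the Schläfli graph, the Gosset graph, or a cartesian product of graphs from this list which all have the same (constant) Ollivier curvature.
   Context: $d$ is the combinatorial distance, $\operatorname{Deg}(v)$ the degree, $\operatorname{diam}_{\operatorname{eff}}(G)=\frac{1}{|V|^2}\sum_{x,y\in V}d(x,y)$. Laplacian: $\Delta f(x)=\sum_{y\sim x}(f(y)-f(x))$. Ollivier curvature of an edge $x\sim y$: $\kappa(x,y)=\inf\{\Delta f(x)-\Delta f(y): f(y)-f(x)=1,\ \max_{u\sim v}|f(u)-f(v)|=1\}$. For adjacent $x\sim y$ let $V_x^y=\{v: d(v,x)<d(v,y)\}$ and $V^{xy}=\{v:d(v,x)=d(v,y)\}$. A map $\phi:V\to V$ is a reflection from $x$ to $y$ if: $\phi$ is a graph automorphism; $\phi\circ\phi=\mathrm{id}$; $\phi(x)=y$; the set of edges between $V_x^y$ and $V_y^x$ is exactly $\{\{x',\phi(x')\}: x'\in V_x^y\}$; and $\phi(z)=z$ for all $z\in V^{xy}$. $G$ is reflective if for every edge $x\sim y$ there exists a reflection from $x$ to $y$. Cocktail party graph $CP(k)$: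 $K_{2k}$ minus a perfect matching. Johnson graph $J(n,k)$: $k$-subsets of an $n$-set, adjacent iff they share $k-1$ elements. Halved cube: vertices are binary strings of length $n$ of even weight, adjacent iff they differ in exactly two coordinates. Schläfli graph: the unique strongly regular graph with parameters $(27,16,10,8)$. Gosset graph: the 56-vertex, 27-regular distance regular graph (1-skeleton of the $3_{21}$ polytope). Cartesian product $G_1\times G_2$: vertex set $V_1\times V_2$, $(a,b)\sim(a',b')$ iff ($a=a'$, $b\sim b'$) or ($a\sim a'$, $b=b'$). *)

(* Defs.v *)
From HB Require Import structures.
From mathcomp Require Import all_boot all_order all_algebra.
From mathcomp Require Import boolp classical_sets reals.

Set Implicit Arguments.
Unset Strict Implicit.
Unset Printing Implicit Defensive.

Import Order.TTheory GRing.Theory Num.Theory.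

Local Open Scope ring_scope.
Local Open Scope classical_set_scope.

Record graph := Graph { vert : finType; adj : rel vert }.
Arguments adj : clear implicits.

Definition simple_graph (G : graph) :=
  symmetric (adj G) /\ irreflexive (adj G).

Definition connected (G : graph) := forall x y : vert G, connect (adj G) x y.

Section GraphNotions.
Variable G : graph.

Fixpoint within (n : nat) (x y : vert G) : bool :=
  if n is m.+1 then within m x y || [exists z, within m x z && adj G z y]
  else x == y.

(* combinatorial distance (length of a shortest path); for connected
   graphs the distance is < #|V| so the search range suffices *)
Definition dist (x y : vert G) : nat :=
  find (fun n => within n x y) (iota 0 #|vert G|).

Definition deg (v : vert G) : nat := #|[set y | adj G v y]|.

Definition maxdeg : nat := (\max_(v : vert G) deg v)%N.

Definition reflection (x y : vert G) (phi : vert G -> vert G) :=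
  [/\ bijective phi /\ (forall u v, adj G (phi u) (phi v) = adj G u v),
      (forall u, phi (phi u) = u),
      phi x = y,
      (* edges between V_x^y and V_y^x are exactly {x', phi x'}, x' in V_x^y *)
      (forall u v, (dist u x < dist u y)%N -> (dist v y < dist v x)%N ->
          adj G u v -> v = phi u) /\
      (forall u, (dist u x < dist u y)%N ->
          (dist (phi u) y < dist (phi u) x)%N /\ adj G u (phi u))
    & forall z, dist z x = dist z y -> phi z = z].

Definition reflective :=
  forall x y : vert G, adj G x y -> exists phi, reflection x y phi.

Variable R : realType.

Definition diam_eff : R :=
  (\sum_(x : vert G) \sum_(y : vert G) (dist x y)%:R) / (#|vert G| ^ 2)%:R.

Definition lap (f : vert G -> R) (x : vert G) : R :=
  \sum_(y : vert G | adj G x y) (f y - f x).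

Definition ocurv (x y : vert G) : R :=
  inf [set r : R | exists f : vert G -> R,
         [/\ f y - f x = 1,
             (forall u v, adj G u v -> `|f u - f v| <= 1),
             (exists u v, adj G u v /\ `|f u - f v| = 1)
           & r = lap f x - lap f y]].

Definition const_curv (k : R) :=
  forall x y : vert G, adj G x y -> ocurv x y = k.

Definition eff_BM_sharp :=
  exists K : R,
    [/\ (exists x y : vert G, adj G x y /\ ocurv x y = K),
        (forall x y : vert G, adj G x y -> K <= ocurv x y),
        0 < K
      & diam_eff = (maxdeg)%:R / K].

End GraphNotions.
Arguments within : clear implicits.
Arguments dist : clear implicits.
Arguments deg : clear implicits.
Arguments maxdeg : clear implicits.
Arguments reflection : clear implicits.
Arguments reflective : clear implicits.
Arguments diam_eff : clear implicits.
Arguments lap : clear implicits.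
Arguments ocurv : clear implicits.
Arguments const_curv : clear implicits.
Arguments eff_BM_sharp : clear implicits.

Local Close Scope classical_set_scope.

Definition iso (G H : graph) :=
  exists f : vert G -> vert H,
    bijective f /\ forall x y, adj H (f x) (f y) = adj G x y.

Definition cart (G1 G2 : graph) : graph :=
  @Graph (vert G1 * vert G2)%type
    (fun p q => ((p.1 == q.1) && adj G2 p.2 q.2) || (adj G1 p.1 q.1 && (p.2 == q.2))).

(* cocktail party graph CP(k): K_{2k} minus the perfect matching {(false,i),(true,i)} *)
Definition cocktail (k : nat) : graph :=
  @Graph (bool * 'I_k)%type (fun p q => p.2 != q.2).

Definition johnson (n k : nat) : graph :=
  @Graph {A : {set 'I_n} | #|A| == k}
    (fun A B => #|val A :&: val B| == k.-1).

(* halved n-cube: even-weight binary strings of length n (as subsets of 'I_n),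
   adjacent iff they differ in exactly two coordinates *)
Definition halved_cube (n : nat) : graph :=
  @Graph {A : {set 'I_n} | ~~ odd #|A|}
    (fun A B => #|(val A :\: val B) :|: (val B :\: val A)| == 2).

Definition srg (G : graph) (v k l m : nat) :=
  [/\ simple_graph G, #|vert G| = v,
      (forall x, deg G x = k),
      (forall x y, adj G x y -> #|[set z | adj G x z && adj G y z]| = l)
    & (forall x y, x != y -> ~~ adj G x y -> #|[set z | adj G x z && adj G y z]| = m)].

(* The Schlafli graph: the unique srg(27,16,10,8) *)
Definition schlafli (G : graph) := srg G 27 16 10 8.

Definition gosset : graph :=
  @Graph (bool * {A : {set 'I_8} | #|A| == 2})%type
    (fun p q => if p.1 == q.1 then #|val p.2 :&: val q.2| == 1
                else [disjoint val p.2 & val q.2]).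

Definition basic (G : graph) :=
  (exists k, (2 <= k)%N /\ iso G (cocktail k)) \/
  (exists n k, (1 <= k < n)%N /\ iso G (johnson n k)) \/
  (exists n, (2 <= n)%N /\ iso G (halved_cube n)) \/
  schlafli G \/
  iso G gosset.

Inductive prod_class (R : realType) (k : R) : graph -> Prop :=
| pc_base G : basic G -> const_curv G R k -> prod_class k G
| pc_prod G1 G2 G : prod_class k G1 -> prod_class k G2 ->
                    iso G (cart G1 G2) -> prod_class k G.

Definition class_iii (R : realType) (G : graph) :=
  basic G \/ exists k : R, prod_class k G.

(* Main.v *)
Require Import Defs.
From HB Require Import structures.
From mathcomp Require Import all_boot all_order all_algebra.
From mathcomp Require Import boolp classical_sets reals.
From mathcomp Require Import zify ring lra.
(* Again, because [classical_sets] shadows lemmas such as [subsetP]. *)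
From mathcomp Require Import fintype finset.

(* Call [y] the translate of [x] along an edge [u v] when
   [d(w, x) + d(w, v) = d(w, u) + d(w, y)] for all [w], that is [y - x = v - u]
   if vertices are seen as points with inner product [c - d].  A connected graph
   is reflective iff every edge [u v] translates every [x] closer to [u] than to
   [v]; the reflection exchanges such an [x] with its translate.

   Curvature: summing [Delta d(w, .)] along geodesics gives
   [Delta d(w, .) <= deg w - K d(w, .)], and summing over the vertices shows that
   sharpness means equality everywhere.  For reflective graphs equality holds
   with [K = 2 + #common neighbours]; conversely equality and a Hall-type test
   function force the neighbours of [u] and of [v] to be uniquely matched, which
   produces the translates.

   Classification: every vertex is [x] plus a sum of [y - x] over a coclique of
   neighbours [y] of [x], so the graph induced on the neighbours of one vertex
   determines the whole graph.  The components of that local graph are again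
   reflective, of diameter at most 2, so by induction each is a small product of
   graphs of the list and hence itself the local graph of one: K_a x K_b for
   J(a + b, a), CP(k) for CP(k + 1), J(n, 2) for the halved n-cube, the halved
   5-cube for the Schlafli graph and the Schlafli graph for the Gosset graph. *)

Set Implicit Arguments.
Unset Strict Implicit.
Unset Printing Implicit Defensive.

Import Order.TTheory GRing.Theory Num.Theory.

Set Default Proof Using "All".

(** * Graph distance *)

(** A reflection speaks about one edge and is hard to combine with others, whereas [parallel] is a
    linear identity between distance functions: instances along a chain of squares add up, and they
    pass to products and to components of local graphs. Hence the classification works with
    [translational] throughout. A vertex is usually represented by several cocliques. This is
    harmless because distances between represented vertices are given by a bilinear formula in
    distances near [x], whichever cocliques are chosen. The induction of the classification is on
    the number of vertices: a local component misses its centre. The diameter bound serves twice.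
    Distances inside a component are those of the whole graph, so translates can be taken inside it;
    and since diameters add in a product, only products of two complete graphs and a few graphs of
    the list can occur. Several components are assembled by a cartesian product, whose local graphs
    are disjoint unions of local graphs of the factors. *)

Definition simple_connected (G : graph) := simple_graph G /\ connected G.

Section Metric.
Variable G : graph.
Hypothesis gG : simple_connected G.
Implicit Types x y z u v w : vert G.

Lemma adjC x y : adj G x y = adj G y x.
Proof. by case: gG => -[s _] _; rewrite s. Qed.

Lemma adj_irr x : adj G x x = false.
Proof. by case: gG => -[_ ->]. Qed.

Lemma within_path x p : path (adj G) x p -> within G (size p) x (last x p).
Proof.
elim/last_ind: p => [_ //=|p z IH]; rewrite rcons_path size_rcons last_rcons.
move=> /andP[/IH Hw Hz] /=; apply/orP; right; apply/existsP; exists (last x p).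
by rewrite Hw.
Qed.

Lemma within_dist x y : within G (dist G x y) x y.
Proof.
have /connectP [p Hp ->] := gG.2 x y.
have [q Hq uq _] := shortenP Hp.
have sq : size q < #|vert G| by move: (max_card (mem (x :: q))); rewrite (card_uniqP uq).
have H : has (fun n => within G n x (last x q)) (iota 0 #|vert G|).
  by apply/hasP; exists (size q); [rewrite mem_iota | exact: within_path].
by move: (nth_find 0 H); rewrite nth_iota // -[X in _ < X](size_iota 0) -has_find.
Qed.

Lemma dist_le_within n x y : within G n x y -> dist G x y <= n.
Proof.
move=> Hn; rewrite leqNgt; apply/negP=> lt.
have lt2 : n < #|vert G|.
  by apply: (leq_trans lt); rewrite -[X in _ <= X](size_iota 0) find_size.
by have := before_find 0 lt; rewrite nth_iota // Hn.
Qed.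

Lemma dist0 x : dist G x x = 0.
Proof. by apply/eqP; rewrite -leqn0; apply: dist_le_within => /=. Qed.

Lemma dist_eq0 x y : (dist G x y == 0) = (x == y).
Proof.
apply/eqP/eqP => [H|->]; last exact: dist0.
by have := within_dist x y; rewrite H => /eqP.
Qed.

Lemma dist_stepl x y z : adj G y z -> dist G x z <= (dist G x y).+1.
Proof.
move=> a; apply: dist_le_within => /=; apply/orP; right; apply/existsP; exists y.
by rewrite within_dist.
Qed.

Lemma dist_pred x y n : dist G x y = n.+1 ->
  exists2 z, adj G z y & dist G x z = n.
Proof.
move=> H; have := within_dist x y; rewrite H /= => /orP[/dist_le_within|].
  by rewrite H ltnn.
move=> /existsP[z /andP[/dist_le_within w a]]; exists z => //.
by have := dist_stepl x a; lia.
Qed.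

Lemma dist_stepr x y z : adj G x z -> dist G x y <= (dist G z y).+1.
Proof.
move En: (dist G z y) => n; elim: n y En => [|n IH] y En a.
  by move/eqP: En; rewrite dist_eq0 => /eqP <-; have := dist_stepl x a; rewrite dist0.
have [q aq dq] := dist_pred En.
by have := IH _ dq a; have := dist_stepl x aq; lia.
Qed.

Lemma distC x y : dist G x y = dist G y x.
Proof.
suff H n u v : dist G u v = n -> dist G v u <= n.
  by apply/eqP; rewrite eqn_leq !(H _ _ _ erefl).
elim: n u v => [|n IH] u v E; first by move/eqP: E; rewrite dist_eq0 => /eqP ->; rewrite dist0.
have [z a /IH] := dist_pred E.
by have := dist_stepr u (z := z) (x := v); rewrite adjC => /(_ a); lia.
Qed.

Lemma dist_triangle y x z : dist G x z <= dist G x y + dist G y z.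
Proof.
move En: (dist G y z) => n; elim: n z En => [|n IH] z En.
  by move/eqP: En; rewrite dist_eq0 => /eqP <-; rewrite addn0.
have [q aq dq] := dist_pred En.
by have := IH _ dq; have := dist_stepl x aq; lia.
Qed.

Lemma dist_eq1 x y : (dist G x y == 1) = adj G x y.
Proof.
apply/eqP/idP => [H|a].
  by have [z a /eqP] := dist_pred H; rewrite dist_eq0 => /eqP ->.
have := dist_stepl x a; rewrite dist0 => H.
have : dist G x y != 0 by rewrite dist_eq0; apply: contraTneq a => ->; rewrite adj_irr.
by lia.
Qed.

Lemma dist_adj x y : adj G x y -> dist G x y = 1.
Proof. by rewrite -dist_eq1 => /eqP. Qed.

Lemma dist_gt1 x y : x != y -> ~~ adj G x y -> 1 < dist G x y.
Proof. by rewrite -dist_eq0 -dist_eq1 => /eqP n0 /eqP n1; lia. Qed.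

Lemma dist_eq2 x y z : adj G x y -> adj G y z -> x != z -> ~~ adj G x z ->
  dist G x z = 2.
Proof.
move=> a b ne na; have := dist_gt1 ne na; have := dist_triangle y x z.
rewrite (dist_adj a) (dist_adj b) => H1 H2; lia.
Qed.

Lemma adj_neq x y : adj G x y -> x != y.
Proof. by move=> a; apply: contraTneq a => ->; rewrite adj_irr. Qed.

Lemma dist_adj_cases w x y : adj G x y ->
  [\/ dist G w x = dist G w y, dist G w y = (dist G w x).+1 |
      dist G w x = (dist G w y).+1].
Proof.
move=> a; have H1 := dist_stepl w a; move: a; rewrite adjC => a.
have H2 := dist_stepl w a.
have : dist G w x = dist G w y \/ dist G w y = (dist G w x).+1 \/
  dist G w x = (dist G w y).+1 by lia.
by case=> [|[|]] H; [apply: Or31|apply: Or32|apply: Or33].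
Qed.

End Metric.

(** Recognition of the metric of a concrete graph: a function that grows by at most one along an
    edge is bounded by the distance, and one that can be lowered by one along an edge bounds it from
    above. The descent also yields connectedness. *)
Lemma dist_unique (G : graph) (del : vert G -> vert G -> nat) :
  simple_graph G ->
  (forall x, del x x = 0) -> (forall x y, del x y = 0 -> x = y) ->
  (forall x y z, adj G y z -> del x z <= (del x y).+1) ->
  (forall x y n, del x y = n.+1 -> exists2 z, adj G z y & del x z = n) ->
  simple_connected G /\ forall x y, dist G x y = del x y.
Proof.
move=> sG d0 dI dS dP.
have cG : connected G.
  move=> x y; move En: (del x y) => n; elim: n y En => [|n IH] y En.
    by rewrite (dI _ _ En).
  by have [z a /IH c] := dP _ _ _ En; apply: (connect_trans c); apply: connect1.
have gG : simple_connected G by [].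
split=> // x y; apply/eqP; rewrite eqn_leq; apply/andP; split.
  move En: (del x y) => n; elim: n y En => [|n IH] y En.
    by rewrite (dI _ _ En) dist0.
  by have [z a /IH c] := dP _ _ _ En; have := dist_stepl gG x a; lia.
move En: (dist G x y) => n; elim: n y En => [|n IH] y En.
  by move/eqP: En; rewrite dist_eq0 // => /eqP ->; rewrite d0.
have [z a /IH c] := dist_pred gG En; have := dS x _ _ a; lia.
Qed.

(** * Translates and reflections *)

(* Thinking of the vertices as points with inner product [c - dist], this says
   that [y - x = v - u]. *)
Definition parallel (G : graph) (u v x y : vert G) :=
  forall w, dist G w x + dist G w v = dist G w u + dist G w y.

Definition translational (G : graph) := forall u v x : vert G,
  adj G u v -> dist G x v = (dist G x u).+1 -> exists y, parallel u v x y.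

Section Translational.
Variable G : graph.
Hypothesis gG : simple_connected G.
Implicit Types x y z u v w : vert G.

Lemma parallel_adj u v x y : parallel u v x y -> dist G x v = (dist G x u).+1 ->
  adj G x y.
Proof. by move=> /(_ x); rewrite -(dist_eq1 gG) dist0 //; lia. Qed.

(** The edge [u v] is slid along a geodesic from [u] to [x], one square at a time, and the
    identities of the successive squares add up. *)
Lemma translational_local :
  (forall u v x, adj G u v -> adj G u x -> dist G v x = 2 ->
     exists y, parallel u v x y) -> translational G.
Proof.
move=> loc u v x a; move En: (dist G x u) => n.
elim: n u v x a En => [|n IH] u v x a En Ev.
  exists v => w; move/eqP: En; rewrite dist_eq0 // => /eqP ->; lia.
have [p ap dp] := dist_pred gG En.
have pv : dist G v p = 2.
  rewrite distC //; have := dist_triangle gG p x v; have := dist_triangle gG u p v.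
  by rewrite (dist_adj gG a) (dist_adj gG ap); lia.
have up : adj G u p by rewrite adjC.
have [q Hq] := loc _ _ _ a up pv.
have apq : adj G p q.
  by apply: (parallel_adj Hq); rewrite (dist_adj gG ap) distC.
have [|y Hy] := IH p q x apq dp; first by have := Hq x; lia.
by exists y => w; have := Hq w; have := Hy w; lia.
Qed.

Lemma dist_map_le (F : vert G -> vert G) :
  (forall a b, adj G a b -> F a = F b \/ adj G (F a) (F b)) ->
  forall a b, dist G (F a) (F b) <= dist G a b.
Proof.
move=> HF a b; move En: (dist G a b) => n; elim: n b En => [|n IH] b En.
  by move/eqP: En; rewrite dist_eq0 // => /eqP ->; rewrite dist0.
have [z az /IH] := dist_pred gG En.
by case: (HF _ _ az) => [->|/(dist_stepl gG (F a))]; lia.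
Qed.

Lemma reflection_isometry u v phi : reflection G u v phi ->
  forall a b, dist G (phi a) (phi b) = dist G a b.
Proof.
case=> -[_ hom] inv _ _ _.
have H := dist_map_le (fun a b (e : adj G a b) => or_intror (etrans (hom a b) e)).
by move=> a b; apply/eqP; rewrite eqn_leq H -{1}(inv a) -{1}(inv b) H.
Qed.

Lemma reflection_far u v phi w : reflection G u v phi ->
  dist G w v < dist G w u -> dist G (phi w) u < dist G (phi w) v.
Proof.
move=> r; have iso := reflection_isometry r; case: r => _ inv e _ _.
by rewrite -(iso w v) -(iso w u) -e inv.
Qed.

(** The map [F] folds the half nearer [v] onto the half nearer [u]. Edges between the halves
    collapse and equidistant vertices stay fixed, so [F] does not increase distances; it fixes [w]
    and sends [phi x] to [x]. *)
Lemma reflection_fold u v phi w x : reflection G u v phi ->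
  dist G w u < dist G w v -> dist G x u < dist G x v ->
  dist G w x <= dist G w (phi x).
Proof.
move=> r wu xu; have far := fun z => @reflection_far u v phi z r.
case: r => -[_ hom] inv _ [cross near] fix_.
pose F z := if dist G z v < dist G z u then phi z else z.
have HF : forall a b, adj G a b -> F a = F b \/ adj G (F a) (F b).
  move=> a b ab; have ba : adj G b a by rewrite adjC.
  rewrite /F; case: (ltngtP (dist G a v) (dist G a u)) => ha;
    case: (ltngtP (dist G b v) (dist G b u)) => hb;
    rewrite ?hom; try (by right).
  - by left; rewrite (cross b a hb ha ba) inv.
  - by right; rewrite -[b]fix_ ?hom.
  - by left; rewrite (cross a b ha hb ab) inv.
  - by right; rewrite -[a]fix_ ?hom.
have := dist_map_le HF w (phi x).
have [hx _] := near x xu.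
by rewrite /F hx inv; case: ifP => //; lia.
Qed.

(** In the square [u v y x] the edge [x y] runs between the two halves, so the reflection from [u]
    to [v] sends [x] to [y]. The first claim is then folding; the second holds because the
    reflection fixes [w]. *)
Lemma reflective_square u v x y w : reflective G ->
  adj G u v -> adj G x y -> adj G u x -> adj G v y ->
  dist G v x = 2 -> dist G u y = 2 ->
  (dist G w v = (dist G w u).+1 -> dist G w x <= dist G w y) /\
  (dist G w v = dist G w u -> dist G w x = dist G w y).
Proof.
move=> rG uv xy ux vy dvx duy; have [phi r] := rG u v uv.
have xu : dist G x u < dist G x v.
  by rewrite ![dist G x _]distC // dvx (dist_adj gG ux).
have yv : dist G y v < dist G y u.
  by rewrite ![dist G y _]distC // duy (dist_adj gG vy).
have ey : y = phi x by case: r => _ _ _ [cross _] _; exact: cross.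
split=> H.
  by rewrite ey; apply: (reflection_fold r) => //; rewrite H.
have ew : phi w = w by case: r => _ _ _ _; apply; rewrite H.
by rewrite ey -{2}ew (reflection_isometry r).
Qed.

(** The increments of the distance from [w] along [u v] and along [x y] lie in {-1, 0, 1}.
    Reflecting along [u v], [v u] and [x y] shows that they have the same sign. *)
Lemma reflective_translational : reflective G -> translational G.
Proof.
move=> rG; apply: translational_local => u v x uv ux dvx.
have [phi r] := rG u v uv.
have xu : dist G x u < dist G x v.
  by rewrite ![dist G x _]distC // dvx (dist_adj gG ux).
have [yv xy] : dist G (phi x) v < dist G (phi x) u /\ adj G x (phi x).
  by case: r => _ _ _ [_ near] _; exact: near.
exists (phi x) => w; set y := phi x in yv xy *.
have vy : adj G v y.
  case: r => -[_ hom] _ e _ _; by rewrite -e hom.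
have duy : dist G u y = 2.
  move: yv (dist_triangle gG v y u); rewrite [dist G y v]distC //.
  rewrite [dist G v u]distC // (dist_adj gG vy) (dist_adj gG uv) [dist G y u]distC //.
  lia.
have dxv : dist G x v = 2 by rewrite distC.
have dyu : dist G y u = 2 by rewrite distC.
have vu : adj G v u by rewrite adjC.
have yx : adj G y x by rewrite adjC.
have [le1 eq1] := reflective_square w rG uv xy ux vy dvx duy.
have [le2 _] := reflective_square w rG vu yx vy ux duy dvx.
have [_ eq3] : (dist G w y = (dist G w x).+1 -> dist G w u <= dist G w v) /\
  (dist G w y = dist G w x -> dist G w u = dist G w v).
  by apply: reflective_square => //; rewrite adjC.
case: (dist_adj_cases gG w uv) => h1.
- by rewrite (eq1 (esym h1)) h1 addnC.
- have := le1 h1; case: (dist_adj_cases gG w xy) => h2; lia.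
- have := le2 h1; case: (dist_adj_cases gG w xy) => h2; lia.
Qed.

Lemma translational_reflection u v : translational G -> adj G u v ->
  exists2 phi, reflection G u v phi &
    forall z, dist G z u < dist G z v -> parallel u v z (phi z).
Proof.
move=> tG uv; have vu : adj G v u by rewrite adjC.
have /fin_all_exists [phi Hphi] : forall w, exists y,
  [/\ dist G w u < dist G w v -> parallel u v w y,
      dist G w v < dist G w u -> parallel v u w y &
      dist G w u = dist G w v -> y = w].
  move=> w; case: (dist_adj_cases gG w uv) => h.
  - by exists w; split=> //; lia.
  - by have [y Hy] := tG _ _ _ uv h; exists y; split=> //; lia.
  - by have [y Hy] := tG _ _ _ vu h; exists y; split=> //; lia.
have duv := dist_adj gG uv; have dvu := dist_adj gG vu.
have swap w : dist G (phi w) u = dist G w v /\ dist G (phi w) v = dist G w u.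
  have := dist_adj_cases gG w uv; rewrite ![dist G _ u]distC // ![dist G _ v]distC //.
  have [h1 h2 h3] := Hphi w; rewrite ![dist G w _]distC // in h1 h2 h3.
  case=> h; first by rewrite h3.
    have p := h1 ltac:(lia); have := p u; have := p v; rewrite !dist0 //; lia.
  have p := h2 ltac:(lia); have := p u; have := p v; rewrite !dist0 //; lia.
(* [E] says that [phi w] is [w + (v - u)], [w - (v - u)] or [w] according to the side of [w], with
   truth values as coefficients and without subtraction. Involutivity, isometry and the edges
   between the halves are read off from it. *)
have E w w' : (dist G w' (phi w) + (dist G w u < dist G w v) * dist G w' u +
    (dist G w v < dist G w u) * dist G w' v =
    dist G w' w + (dist G w u < dist G w v) * dist G w' v +
    (dist G w v < dist G w u) * dist G w' u)%N.
  have [h1 h2 h3] := Hphi w.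
  case: (ltngtP (dist G w u) (dist G w v)) => h.
  - by have := h1 h w'; lia.
  - by have := h2 h w'; lia.
  - by rewrite h3.
have inv w : phi (phi w) = w.
  apply/eqP; rewrite eq_sym -(dist_eq0 gG); apply/eqP.
  have := E (phi w) w; have := E w w; have [-> ->] := swap w.
  by rewrite dist0 //; case: (dist_adj_cases gG w uv) => ->; rewrite ?ltnn ?ltnS ?leqnn ?ltnNge ?leqnSn /=; lia.
have isom a b : dist G (phi a) (phi b) = dist G a b.
  have := E b (phi a); have [-> ->] := swap a; rewrite [dist G (phi a) b]distC //.
  have := E a b; rewrite [dist G b a]distC //.
  have ha := dist_adj_cases gG a uv; have hb := dist_adj_cases gG b uv.
  case: (ltngtP (dist G a u) (dist G a v)) => h; case: (ltngtP (dist G b u) (dist G b v)) => h';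
    case: ha => ha; case: hb => hb; lia.
exists phi; last by move=> z hz; have [h _ _] := Hphi z; apply: h.
split=> //.
- split; first by exists phi.
  by move=> a b; rewrite -!(dist_eq1 gG) isom.
- by apply/eqP; rewrite -(dist_eq0 gG); have [_ ->] := swap u; rewrite dist0.
- split.
    move=> a b ha hb ab; apply/eqP; rewrite -(dist_eq0 gG).
    have := E a b; rewrite ha [_ < dist G a u]ltnNge (ltnW ha) /= [dist G b a]distC //.
    rewrite (dist_adj gG ab); have := dist_adj_cases gG b uv; case; lia.
  move=> a ha; have [-> ->] := swap a; split=> //; rewrite -(dist_eq1 gG).
  have := E a a; rewrite ha [_ < dist G a u]ltnNge (ltnW ha) /= dist0 //.
  have := dist_adj_cases gG a uv; case; lia.
- by move=> z hz; have [_ _] := Hphi z; apply.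
Qed.

Lemma translational_reflective : translational G -> reflective G.
Proof.
by move=> tG u v uv; have [phi r _] := translational_reflection tG uv; exists phi.
Qed.

End Translational.

(** * Curvature of reflective graphs *)

Definition common (G : graph) (u v : vert G) : nat :=
  #|[set z | adj G u z && adj G v z]|.

(** The set in [deg] is one of [classical_sets]; this passes to the boolean predicate over which big
    operators range. *)
Lemma degE (G : graph) (x : vert G) : deg G x = #|adj G x|.
Proof. by apply: eq_card => y; apply/idP/idP => [/set_mem|a] //; apply/mem_set. Qed.

Section Curvature.
Variables (R : realType) (G : graph).
Hypothesis gG : simple_connected G.
Implicit Types x y z u v w : vert G.
Local Open Scope ring_scope.

Definition lipschitz (f : vert G -> R) := forall a b, adj G a b -> `|f a - f b| <= 1.

Lemma lipschitz_lap (f : vert G -> R) x : lipschitz f -> `|lap G R f x| <= (deg G x)%:R.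
Proof.
move=> Lf; apply: (le_trans (ler_norm_sum _ _ _)).
rewrite degE -sum1_card natr_sum; apply: ler_sum => y a.
by rewrite distrC Lf.
Qed.

(** [inf] is a lower bound only of a set that is bounded below; the bound comes from
    [lipschitz_lap]. The edge [x y] itself attains the maximum 1 required of a test function. *)
Lemma ocurv_le (f : vert G -> R) x y : adj G x y -> f y - f x = 1 -> lipschitz f ->
  ocurv G R x y <= lap G R f x - lap G R f y.
Proof.
move=> a fxy Lf; apply: ge_inf; last first.
  exists f; split=> //; exists y, x; rewrite adjC // a fxy normr1; split=> //.
exists (- (deg G x)%:R - (deg G y)%:R) => _ [g [_ Lg _ ->]].
have := lipschitz_lap x Lg; have := lipschitz_lap y Lg.
by rewrite !ler_norml => /andP[_ h1] /andP[h2 _]; lra.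
Qed.

Lemma ocurv_ge (K : R) x y : (exists2 f : vert G -> R, f y - f x = 1 & lipschitz f) ->
  adj G x y ->
  (forall f : vert G -> R, f y - f x = 1 -> lipschitz f -> K <= lap G R f x - lap G R f y) ->
  K <= ocurv G R x y.
Proof.
move=> [f fxy Lf] a H; apply: lb_le_inf.
  exists (lap G R f x - lap G R f y), f; split=> //.
  by exists y, x; rewrite adjC // a fxy normr1.
by move=> _ [g [gxy Lg _ ->]]; exact: H.
Qed.

(** The reflection maps the neighbours of [u] onto those of [v] and acts as a transport plan: the
    term of [z] is paired with that of [phi z]. *)
Lemma reflection_lap (f : vert G -> R) u v phi : reflection G u v phi ->
  lap G R f u - lap G R f v =
  \sum_(z | adj G u z) (f z - f (phi z) + (f v - f u)).
Proof.
case=> -[bij hom] inv e _ _.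
rewrite /lap [X in _ - X](reindex phi) /=; last exact: onW_bij.
rewrite [X in _ - X](eq_bigl (adj G u)); last by move=> z; rewrite -e hom.
by rewrite -sumrB; apply: eq_bigr => z _; ring.
Qed.

(** The summand is the share of the neighbour [z] in the curvature of [u v]: 2 for [v] itself, 1 for
    a common neighbour, 0 otherwise. Both bounds on the curvature are proved share by share. *)
Lemma sum_common u v : adj G u v ->
  (\sum_(z | adj G u z) ((z == v).*2 + adj G v z) = (common u v).+2)%N.
Proof.
move=> a; rewrite big_split /= (bigD1 v) //= eqxx big1 ?addn0; last by move=> z /andP[_ /negPf ->].
rewrite add2n; congr _.+2; rewrite /common -sum1_card -big_mkcondr /=.
by apply: eq_bigl => z; rewrite inE.
Qed.

Lemma reflection_nbr_cases u v phi z : reflection G u v phi -> adj G u v -> adj G u z ->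
  [\/ z = v /\ phi z = u, [/\ adj G v z, z != v & phi z = z] |
      [/\ z != v, ~~ adj G v z, dist G z u < dist G z v & adj G z (phi z)]%N].
Proof.
move=> r uv uz; have duz : dist G z u = 1%N by rewrite distC // dist_adj.
case: r => _ inv e [_ near] fix_.
have [->|ne] := eqVneq z v; first by apply: Or31; rewrite -e inv.
case: (boolP (adj G v z)) => vz.
  by apply: Or32; split=> //; apply: fix_; rewrite duz distC // dist_adj.
have lt : (dist G z u < dist G z v)%N.
  by rewrite duz; apply: dist_gt1 => //; rewrite adjC.
by apply: Or33; split=> //; have [] := near z lt.
Qed.

Lemma reflection_ocurv u v phi : adj G u v -> reflection G u v phi ->
  ocurv G R u v = (common u v).+2%:R.
Proof.
move=> uv r; rewrite -(sum_common uv) natr_sum.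
(* The indicator of the half nearer [v] is an optimal test function: it jumps by 1 from [z] to
   [phi z] whenever [z] lies on the side of [u]. *)
pose f w : R := (dist G w v < dist G w u)%N%:R.
have fuv : f v - f u = 1.
  by rewrite /f !dist0 // (dist_adj gG uv) [dist G v u]distC // (dist_adj gG uv) subr0.
have Lf : lipschitz f.
  move=> a b _; rewrite /f; case: (_ < _)%N; case: (_ < _)%N;
    by rewrite /= ?mulr1n ?mulr0n ?subrr ?subr0 ?sub0r ?normrN ?normr1 ?normr0 ?ler01.
apply/eqP; rewrite eq_le; apply/andP; split.
  apply: (le_trans (ocurv_le uv fuv Lf)); rewrite (reflection_lap _ r) fuv.
  apply: ler_sum => z uz; have [[-> ->]|[vz /negPf -> ->]|[/negPf -> /negPf -> lt _]] :=
    reflection_nbr_cases r uv uz.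
  - by rewrite fuv eqxx adj_irr.
  - by rewrite vz subrr add0r.
  - rewrite /f; have -> : (dist G z v < dist G z u)%N = false by lia.
    have -> : (dist G (phi z) v < dist G (phi z) u)%N.
      have iso := reflection_isometry gG r; case: r => _ inv e _ _.
      have ev : phi v = u by rewrite -e inv.
      by rewrite -(iso _ v) -(iso _ u) inv e ev.
    by rewrite /= sub0r addNr.
(* Conversely any test function rises by at most 1 from an outer neighbour [z] to the adjacent
   [phi z]; the shares of [v] and of the common neighbours are exact. *)
apply: ocurv_ge => //; first by exists f.
move=> g guv Lg; rewrite (reflection_lap _ r) guv.
apply: ler_sum => z uz; have [[-> ->]|[vz /negPf -> ->]|[/negPf -> /negPf -> _ az]] :=
    reflection_nbr_cases r uv uz.
- by rewrite guv eqxx adj_irr.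
- by rewrite vz subrr add0r.
- have := Lg _ _ az; rewrite ler_norml => /andP[h1 h2].
  rewrite [X in X <= _](_ : _ = 0) //; lra.
Qed.

Lemma sum_lap (f : vert G -> R) : \sum_x lap G R f x = 0.
Proof.
rewrite /lap pair_big_dep /=; set S := bigop _ _ _.
suff : S = - S by lra.
rewrite {1}/S (reindex (fun p => (p.2, p.1))) /=; last first.
  by exists (fun p => (p.2, p.1)) => -[].
rewrite /S -sumrN; apply: eq_big => [[a b]|[a b] _] /=; first exact: adjC.
by rewrite opprB.
Qed.

Lemma sum_dist_lap (D K : R) w :
  (forall y, lap G R (fun z => (dist G w z)%:R) y = D - K * (dist G w y)%:R) ->
  #|vert G|%:R * D = K * \sum_y (dist G w y)%:R.
Proof.
move=> H; have := sum_lap (fun z => (dist G w z)%:R).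
rewrite (eq_bigr _ (fun y _ => H y)) sumrB sumr_const -mulr_sumr -[D *+ _]mulr_natl.
by move/eqP; rewrite subr_eq0 => /eqP.
Qed.

Lemma lap_dist_self w : lap G R (fun z => (dist G w z)%:R) w = (deg G w)%:R.
Proof.
rewrite /lap degE -sum1_card natr_sum; apply: eq_bigr => y a.
by rewrite dist0 // (dist_adj gG a) subr0.
Qed.

(** The distance from [w] is optimal for the last edge [u y] of a geodesic from [w]: if [z] is an
    outer neighbour of [u], its translate [phi z] is exactly one step farther from [w]. So the
    Laplacian drops by exactly [k] at each step. *)
Lemma translational_lap_dist (k : R) w y : translational G -> const_curv G R k ->
  lap G R (fun z => (dist G w z)%:R) y = (deg G w)%:R - k * (dist G w y)%:R.
Proof.
move=> tG ck; move En: (dist G w y) => n; elim: n y En => [|n IH] y En.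
  by move/eqP: En; rewrite dist_eq0 // => /eqP <-; rewrite lap_dist_self mulr0 subr0.
have [u uy du] := dist_pred gG En.
have [phi r par] := translational_reflection gG tG uy.
suff: lap G R (fun z => (dist G w z)%:R) u - lap G R (fun z => (dist G w z)%:R) y = k.
  by rewrite (IH u du) -natr1; lra.
rewrite -(ck _ _ uy) (reflection_ocurv uy r) -(sum_common uy) natr_sum (reflection_lap _ r).
rewrite En du -natr1 [n%:R + 1]addrC addrK.
apply: eq_bigr => z uz; have [[-> ->]|[vz /negPf -> ->]|[/negPf -> /negPf -> lt az]] :=
    reflection_nbr_cases r uy uz.
- rewrite eqxx adj_irr // En du; have -> : (true.*2 + false)%:R = 1 + 1 :> R by [].
  by rewrite -natr1; lra.
- by rewrite vz subrr add0r.
- have := par z lt w; rewrite En du => e.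
  have -> : dist G w (phi z) = (dist G w z).+1 by lia.
  by rewrite -natr1 [RHS](_ : _ = 0) //; lra.
Qed.

End Curvature.

(** * Sharpness *)

Lemma connected_const (G : graph) (T : Type) (h : vert G -> T) : simple_connected G ->
  (forall a b, adj G a b -> h a = h b) -> forall a b, h a = h b.
Proof.
move=> [_ cG] H a b; have /connectP [p Hp ->] := cG a b.
by elim: p a Hp => //= c p IH a /andP[/H -> /IH].
Qed.

Lemma translational_regular (G : graph) (a b : vert G) : simple_connected G ->
  translational G -> deg G a = deg G b.
Proof.
move=> gG tG; apply: connected_const => // u v uv; have [phi r _] := translational_reflection gG tG uv.
case: r => -[bij hom] _ e _ _.
rewrite !degE // -!sum1_card [RHS](reindex phi); last exact: onW_bij.
by apply: eq_bigl => z; rewrite /in_mem /= -e hom.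
Qed.

(** * From translates and constant curvature to sharpness *)

Section SharpOfTranslational.
Variables (R : realType) (G : graph).
Hypotheses (gG : simple_connected G) (tG : translational G).

Lemma translational_sharp (k : R) : (exists x y, adj G x y) -> const_curv G R k ->
  eff_BM_sharp G R.
Proof.
move=> [x0 [y0 a]] ck; exists k.
have k0 : (0 < k)%R.
  have [phi r _] := translational_reflection gG tG a.
  by rewrite -(ck _ _ a) (reflection_ocurv R gG a r) ltr0n.
split=> //; first by exists x0, y0; split=> //; exact: ck.
  by move=> x y axy; rewrite (ck _ _ axy).
have dm w : maxdeg G = deg G w.
  apply/eqP; rewrite eqn_leq; apply/andP; split; last exact: (leq_bigmax (F := deg G) w).
  by apply/bigmax_leqP => z _; rewrite (translational_regular z w gG tG).
have V0 : (#|vert G|%:R != 0 :> R)%R by rewrite pnatr_eq0 -lt0n; apply/card_gt0P; exists x0.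
have H w : (\sum_y (dist G w y)%:R = #|vert G|%:R * (maxdeg G)%:R / k :> R)%R.
  rewrite (dm w) (sum_dist_lap gG (fun y => translational_lap_dist (R := R) gG w y tG ck)).
  by field; rewrite gt_eqF.
rewrite /diam_eff (eq_bigr _ (fun w _ => H w)) sumr_const natrX.
rewrite -[(_ / k *+ _)%R]mulr_natl; field.
by rewrite V0 andbT gt_eqF.
Qed.

End SharpOfTranslational.

(** * From sharpness to translates *)

Section TranslationalOfSharp.
Variables (R : realType) (G : graph).
Hypothesis gG : simple_connected G.
Implicit Types u v w x y z : vert G.

Lemma dist_lipschitz w : lipschitz (fun z => (dist G w z)%:R : R)%R.
Proof.
move=> a b ab; case: (dist_adj_cases gG w ab) => ->.
- by rewrite subrr normr0 ler01.
- by rewrite -natr1 opprD addrA subrr sub0r normrN normr1.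
- by rewrite -natr1 addrAC subrr add0r normr1.
Qed.

Lemma lap_dist_le (K : R) w y : (forall x y, adj G x y -> K <= ocurv G R x y)%R ->
  (lap G R (fun z => (dist G w z)%:R) y <= (deg G w)%:R - K * (dist G w y)%:R)%R.
Proof.
move=> HK; move En: (dist G w y) => n; elim: n y En => [|n IH] y En.
  by move/eqP: En; rewrite dist_eq0 // => /eqP <-; rewrite lap_dist_self // mulr0 subr0.
have [u uy du] := dist_pred gG En.
have := IH u du; have := HK _ _ uy.
have := @ocurv_le R G gG (fun z => (dist G w z)%:R)%R _ _ uy.
rewrite En du -natr1 addrAC subrr add0r => /(_ erefl (@dist_lipschitz w)).
lra.
Qed.

Lemma sharp_lap_dist (K : R) : (forall x y, adj G x y -> K <= ocurv G R x y)%R ->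
  (0 < K)%R -> diam_eff G R = ((maxdeg G)%:R / K)%R ->
  forall w y, lap G R (fun z => (dist G w z)%:R)%R y =
    ((maxdeg G)%:R - K * (dist G w y)%:R)%R.
Proof.
move=> HK K0 E w y.
(* The defect is measured against the maximal degree, so its vanishing gives regularity as well. *)
pose gap (p : vert G * vert G) : R := ((maxdeg G)%:R - K * (dist G p.1 p.2)%:R -
  lap G R (fun z => (dist G p.1 z)%:R) p.2)%R.
have gap0 p : (0 <= gap p)%R.
  rewrite /gap; have := lap_dist_le p.1 p.2 HK.
  have : ((deg G p.1)%:R <= (maxdeg G)%:R :> R)%R.
    by rewrite ler_nat; exact: (leq_bigmax (F := deg G) p.1).
  lra.
have V0 : (#|vert G|%:R != 0 :> R)%R by rewrite pnatr_eq0 -lt0n; apply/card_gt0P; exists w.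
have S : (\sum_p gap p = 0)%R.
  rewrite -(pair_bigA _ (fun a b => gap (a, b))) /= /gap /=.
  under eq_bigr do rewrite sumrB sumrB sum_lap // subr0 sumr_const -mulr_sumr.
  rewrite sumrB sumr_const -mulr_sumr.
  move: E; rewrite /diam_eff; set T := bigop _ _ _ => ET.
  have -> : T = (#|vert G|%:R ^+ 2 * ((maxdeg G)%:R / K))%R.
    by rewrite -ET natrX; field.
  rewrite -mulrnA -[(_ *+ (_ * _))%R]mulr_natl natrM; field.
  by rewrite gt_eqF.
have := psumr_eq0P (fun p _ => gap0 p) S isT (i := (w, y)).
by rewrite /gap /=; lra.
Qed.

Variables (D : nat) (K : R).
Hypothesis lapE : forall w y,
  lap G R (fun z => (dist G w z)%:R)%R y = (D%:R - K * (dist G w y)%:R)%R.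
Hypothesis curvK : forall x y, adj G x y -> (K <= ocurv G R x y)%R.

(** The neighbours of [u] that a transport to [v] really has to move. The aim is to show that edges
    match [outer u v] perfectly with [outer v u]. *)
Let outer u v := [set z | adj G u z && (dist G z v == 2)].

Lemma degD w : deg G w = D.
Proof.
have := lapE w w; rewrite lap_dist_self // dist0 // mulr0 subr0.
by move/eqP; rewrite eqr_nat => /eqP.
Qed.

Lemma sum_nbrs (T : nmodType) (F : vert G -> T) u v : adj G u v ->
  (\sum_(z | adj G u z) F z = F v + \sum_(z | adj G u z && adj G v z) F z +
    \sum_(z in outer u v) F z)%R.
Proof.
move=> uv; rewrite (bigD1 v) //= -addrA; congr (_ + _)%R.
rewrite (bigID (adj G v)) /=; congr (_ + _)%R; apply: eq_bigl => z.
  rewrite -andbA; case uz : (adj G u z) => //=; case vz: (adj G v z); rewrite ?andbF //= andbT.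
  by rewrite eq_sym; apply: adj_neq vz.
rewrite inE -andbA; case uz : (adj G u z) => //=.
apply/idP/eqP => [/andP[ne na]|dz].
  have zu : adj G z u by rewrite adjC.
  by apply: (dist_eq2 gG zu uv) => //; rewrite adjC.
apply/andP; split; first by apply: contra_eq_neq dz => ->; rewrite dist0.
by rewrite adjC // -(dist_eq1 gG) dz.
Qed.

Lemma card_outer u v : adj G u v -> D = (common u v + #|outer u v|).+1.
Proof.
move=> uv; rewrite -(degD u) degE // -sum1_card.
have e : \sum_(z | adj G u z) 1 = 1 + \sum_(z | adj G u z && adj G v z) 1 +
  \sum_(z in outer u v) 1 := sum_nbrs (fun=> 1) uv.
rewrite /common -!sum1_card [LHS]e add1n addSn; congr (_ + _).+1.
by apply: eq_bigl => z; rewrite inE.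
Qed.

Lemma card_outerC u v : adj G u v -> #|outer u v| = #|outer v u|.
Proof.
move=> uv; have := card_outer uv; rewrite adjC // in uv; have := card_outer uv.
suff -> : common u v = common v u by lia.
by apply: eq_card => z; rewrite !inE andbC.
Qed.

Lemma lap_diff (f : vert G -> R) u v : adj G u v -> (f v - f u = 1)%R ->
  (lap G R f u - lap G R f v =
   D%:R + 1 + \sum_(z in outer u v) f z - \sum_(z in outer v u) f z)%R.
Proof.
move=> uv fuv; have vu : adj G v u by rewrite adjC.
have L a : (lap G R f a = \sum_(z | adj G a z) f z - D%:R * f a)%R.
  by rewrite /lap sumrB sumr_const -(degD a) degE // mulr_natl.
rewrite !L (sum_nbrs f uv) (sum_nbrs f vu).
have -> : (\sum_(z | adj G v z && adj G u z) f z = \sum_(z | adj G u z && adj G v z) f z)%R.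
  by apply: eq_bigl => z; rewrite andbC.
have -> : (f v = f u + 1)%R by lra.
ring.
Qed.

(** This is [lap_diff] for the distance from [u]. With [card_outer] it reads
    [K = 2 + common u v]. *)
Lemma K_outer u v : adj G u v -> K = (D%:R + 1 - #|outer u v|%:R)%R.
Proof.
move=> uv; have vu : adj G v u by rewrite adjC.
have e : ((dist G u v)%:R - (dist G u u)%:R = 1 :> R)%R by rewrite dist0 // dist_adj // subr0.
have := lap_diff (f := fun z => (dist G u z)%:R%R) uv e; rewrite !lapE dist0 // (dist_adj gG uv).
have -> : (\sum_(z in outer u v) (dist G u z)%:R = #|outer u v|%:R :> R)%R.
  rewrite -sum1_card natr_sum; apply: eq_bigr => z.
  by rewrite inE => /andP[uz _]; rewrite dist_adj.
have -> : (\sum_(z in outer v u) (dist G u z)%:R = 2 * #|outer v u|%:R :> R)%R.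
  rewrite -sum1_card natr_sum mulr_sumr; apply: eq_bigr => z.
  by rewrite inE distC // => /andP[_ /eqP ->]; rewrite mulr1.
rewrite -(card_outerC uv); lra.
Qed.

(** The curvature bound after cancelling the contributions of [v] and of the common neighbours. For
    the distance from a vertex it is an equality, which is [sum_outer_dist]. *)
Lemma sum_outer_le (f : vert G -> R) u v : adj G u v -> (f v - f u = 1)%R -> lipschitz f ->
  (\sum_(z in outer v u) f z <= \sum_(z in outer u v) f z + #|outer u v|%:R)%R.
Proof.
move=> uv fuv Lf; have := le_trans (curvK uv) (ocurv_le gG uv fuv Lf).
rewrite lap_diff // (K_outer uv); lra.
Qed.

Lemma sum_outer_dist w u v : adj G u v -> dist G w v = (dist G w u).+1 ->
  (\sum_(z in outer v u) dist G w z = \sum_(z in outer u v) (dist G w z).+1)%N.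
Proof.
move=> uv E.
have e : ((dist G w v)%:R - (dist G w u)%:R = 1 :> R)%R by rewrite E -natr1; lra.
have := lap_diff (f := fun z => (dist G w z)%:R%R) uv e; rewrite !lapE E (K_outer uv) -natr1 -!natr_sum => h.
apply/eqP; under [X in _ == X]eq_bigr do rewrite -addn1.
rewrite big_split /= sum1_card -(eqr_nat R) natrD; apply/eqP; lra.
Qed.

(* Hall's condition for the bipartite graph between [outer u v] and
   [outer v u], witnessed by a test function with values in {-1, 0, 1}. *)
Lemma card_le_nbrs (A : {set vert G}) u v : adj G u v -> A \subset outer u v ->
  #|A| <= #|[set z in outer v u | [exists a in A, adj G a z]]|.
Proof.
move=> uv sA; set B := [set z in _ | _].
(* The test function is 1 at [v] and on the outer neighbours of [v] not adjacent to [A], -1 on [A]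
   and 0 elsewhere. An edge with a jump of 2 would join the first set to [A], which [cross]
   excludes. *)
pose P z := (z == v) || (z \in outer v u :\: B).
pose f z : R := ((P z)%:R - (z \in A)%:R)%R.
have An z : z \in A -> [/\ z != v, ~~ adj G v z & adj G u z].
  move=> /(subsetP sA); rewrite inE => /andP[uz /eqP dz]; split=> //.
    by apply: contra_eq_neq dz => ->; rewrite dist0.
  by rewrite adjC // -(dist_eq1 gG) dz.
have vA : v \notin A by apply/negP => /An[]; rewrite eqxx.
have uA : u \notin A by apply/negP => /An[_ _]; rewrite adj_irr.
have Pv : P v by rewrite /P eqxx.
have Pu : P u = false.
  have uo : u \notin outer v u by rewrite inE dist0 // andbF.
  by rewrite /P in_setD (negPf uo) andbF orbF (negPf (adj_neq gG uv)).
have AP z : z \in A -> P z = false.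
  case/An => /negPf n1 /negPf n2 _.
  have zo : z \notin outer v u by rewrite inE n2.
  by rewrite /P in_setD n1 (negPf zo) andbF.
have cross a b : adj G a b -> P a -> b \in A -> False.
  move=> ab /orP[/eqP e | ] bA; first by have [_ /negP] := An _ bA; rewrite -e.
  move: bA; rewrite in_setD => /andP[/negP n h] bA; apply: n; rewrite inE h /=.
  by apply/existsP; exists b; rewrite bA adjC.
have fuv : (f v - f u = 1)%R.
  by rewrite /f Pv Pu (negPf vA) (negPf uA) /= subr0 subr0 subr0.
have Lf : lipschitz f.
  have half a b : adj G a b -> (f a - f b <= 1)%R.
    move=> ab; rewrite /f; case bA : (b \in A).
      rewrite (AP b) //; have -> : P a = false by apply/negP => /(cross _ _ ab); apply.
      by case: (a \in A) => /=; lra.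
    by case: (P a); case: (P b); case: (a \in A) => /=; lra.
  by move=> a b ab; rewrite ler_norml; have := half a b ab; rewrite adjC // in ab;
    have := half b a ab; lra.
have := sum_outer_le uv fuv Lf.
have -> : (\sum_(z in outer v u) f z = #|outer v u|%:R - #|B|%:R)%R.
  have /= -> := eq_bigr (fun z => 1 - (z \in B)%:R)%R (P := mem (outer v u)).
    rewrite sumrB sumr_const; congr (_ - _)%R.
    rewrite -natr_sum -big_mkcondr /= sum1_card; congr (_%:R)%R; apply: eq_card => z.
    by rewrite !inE /= [LHS]unfold_in /= !inE; case: (_ && (_ == _)).
  move=> z zo; rewrite /f /P.
  have -> : (z \in A) = false.
    by apply/negP => /An[_ /negPf]; move: zo; rewrite inE => /andP[->].
  have -> : (z == v) = false.
    by apply/negP => /eqP zv; move: zo; rewrite zv inE adj_irr.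
  by rewrite in_setD zo andbT subr0 /=; case: (z \in B); rewrite /= ?subrr ?subr0.
have -> : (\sum_(z in outer u v) f z = - #|A|%:R)%R.
  rewrite -sum1_card natr_sum -sumrN.
  rewrite (big_setID A) /= [X in (_ + X)%R]big1 ?addr0.
    rewrite (setIidPr sA); apply: eq_bigr => z zA; by rewrite /f zA AP // sub0r.
  move=> z /setDP[zo /negPf zA]; rewrite /f zA /P.
  move: zo; rewrite inE => /andP[uz /eqP dz].
  have -> : (z == v) = false.
    by apply/negP => /eqP zv; move: dz; rewrite zv dist0.
  have -> : (z \in outer v u :\: B) = false.
    rewrite in_setD; apply/negP => /andP[_]; rewrite inE => /andP[vz _].
    by move: dz; rewrite distC // dist_adj.
  by rewrite subr0.
by rewrite -(card_outerC uv) -(ler_nat R); lra.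
Qed.

(** Hall's condition for [x] alone gives a neighbour. Uniqueness compares the two sides of
    [sum_outer_dist] taken at [w = x]: Hall's condition for [B], which is [x] with its neighbours in
    [outer u v], leaves room for only one vertex of [outer v u] at distance 1 from [x]. *)
Lemma outer_unique_nbr u v x : adj G u v -> x \in outer u v ->
  #|[set z in outer v u | adj G x z]| = 1.
Proof.
move=> uv xo; set P1 := [set z in _ | _].
have vu : adj G v u by rewrite adjC.
have [ux dx] : adj G u x /\ dist G x v = 2 by move: xo; rewrite inE => /andP[-> /eqP ->].
have xu : adj G x u by rewrite adjC.
pose B := x |: [set z in outer u v | adj G x z].
have sB : B \subset outer u v.
  by apply/subsetP => z; rewrite !inE => /orP[/eqP -> | /andP[]//]; rewrite ux dx.
have := card_le_nbrs uv sB; set GB := [set z in _ | _] => hB.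
have h1 : 0 < #|P1|.
  have := @card_le_nbrs [set x] u v uv; rewrite sub1set cards1 => /(_ xo) h.
  apply: (leq_trans h); apply/subset_leq_card/subsetP => z; rewrite !inE => /andP[-> /=].
  by case/existsP => a /andP[]; rewrite inE => /eqP ->.
have dxv : dist G x v = (dist G x u).+1 by rewrite dx (dist_adj gG xu).
have E := sum_outer_dist uv dxv.
have e1 : \sum_(z in outer u v) (z == x) = 1.
  by rewrite (bigD1 x) //= eqxx big1 // => z /andP[_ /negPf ->].
(* The distances from [x] are 0, 1 or 2 here, and the corrections raise every summand to exactly
   3. *)
have S1 : \sum_(z in outer u v) (dist G x z).+1 + #|B| + \sum_(z in outer u v) (z == x) = 3 * #|outer u v|.
  have -> : #|B| = \sum_(z in outer u v) (z \in B).
    rewrite -sum1_card -big_mkcondr /=; apply: eq_bigl => z.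
    by case: (boolP (z \in B)) => [/(subsetP sB) ->|]; rewrite ?andbF.
  rewrite -!big_split /= mulnC -sum_nat_const; apply: eq_bigr => z zo.
  have [uz dz] : adj G u z /\ dist G z v = 2 by move: zo; rewrite inE => /andP[-> /eqP ->].
  rewrite in_setU1 inE zo /=; have [->|ne] := eqVneq z x; first by rewrite dist0.
  case: (boolP (adj G x z)) => [xz|nxz]; first by rewrite (dist_adj gG xz).
  by rewrite (dist_eq2 gG xu uz) // eq_sym.
(* Here a summand is at most 3: 1 + 1 + 1 for a neighbour of [x], and at most 2 + 0 + 1 for another
   vertex of [GB]. With [E] and [hB] this leaves at most one element in [P1]. *)
have S2 : \sum_(z in outer v u) dist G x z + #|P1| + #|GB| <= 3 * #|outer v u|.
  have -> : #|P1| = \sum_(z in outer v u) adj G x z.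
    rewrite -sum1_card -big_mkcondr /=; apply: eq_bigl => z; by rewrite inE.
  have -> : #|GB| = \sum_(z in outer v u) (z \in GB).
    rewrite -sum1_card -big_mkcondr /=; apply: eq_bigl => z.
    by rewrite !inE; case: (_ && (_ == _)).
  rewrite -!big_split /= mulnC -sum_nat_const; apply: leq_sum => z zo.
  have [vz dz] : adj G v z /\ dist G z u = 2 by move: zo; rewrite inE => /andP[-> /eqP ->].
  have l3 : dist G x z <= 3.
    by have := dist_triangle gG v x z; rewrite dx (dist_adj gG vz).
  case: (boolP (adj G x z)) => [xz|nxz].
    by rewrite (dist_adj gG xz); case: (z \in GB).
  case: (boolP (z \in GB)) => [|_]; last by rewrite !addn0.
  rewrite inE zo /= => /existsP[b /andP[]]; rewrite in_setU1 inE.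
  case/orP=> [/eqP ->|/andP[bo xb] bz]; first by rewrite (negPf nxz).
  have := dist_triangle gG b x z; rewrite (dist_adj gG xb) (dist_adj gG bz) => h.
  move: h; clear; rewrite /=; lia.
by move: S1 S2 hB h1; rewrite E e1 (card_outerC uv); lia.
Qed.

(** Along a matched edge the distance from [w] grows by at most one, and by [sum_outer_dist] the
    total growth over the matching is the largest possible; so it is one on each matched edge. *)
Lemma outer_square u v x y w : adj G u v -> x \in outer u v -> y \in outer v u ->
  adj G x y -> dist G w v = (dist G w u).+1 -> dist G w y = (dist G w x).+1.
Proof.
move=> uv xo yo xy E; have vu : adj G v u by rewrite adjC.
pose Q (p : vert G * vert G) := [&& p.1 \in outer u v, p.2 \in outer v u & adj G p.1 p.2].
have L : \sum_(p | Q p) dist G w p.2 = \sum_(z in outer v u) dist G w z.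
  rewrite (eq_bigl (fun p => (xpredT p.1) && Q (p.1, p.2))); last by case.
  rewrite -(pair_big_dep xpredT (fun a b => Q (a, b)) (fun _ b => dist G w b)) /=.
  rewrite (exchange_big_dep (mem (outer v u))) /=; last by move=> a b _ /and3P[].
  apply: eq_bigr => z zo; rewrite sum_nat_const -[RHS]mul1n; congr (_ * _).
  rewrite -(outer_unique_nbr vu zo); apply: eq_card => a.
  by rewrite inE [LHS]unfold_in /Q /= zo /= adjC.
have Rr : \sum_(p | Q p) (dist G w p.1).+1 = \sum_(z in outer u v) (dist G w z).+1.
  rewrite (eq_bigl (fun p => (p.1 \in outer u v) && Q (p.1, p.2))); last first.
    by case=> a b; rewrite /Q /=; case: (a \in outer u v).
  rewrite -(pair_big_dep (mem (outer u v)) (fun a b => Q (a, b)) (fun a _ => (dist G w a).+1)) /=.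
  apply: eq_bigr => z zo; rewrite sum_nat_const -[RHS]mul1n; congr (_ * _).
  rewrite -(outer_unique_nbr uv zo); apply: eq_card => a.
  by rewrite inE [LHS]unfold_in /Q /= zo.
have [_] : \sum_(p | Q p) dist G w p.2 <= \sum_(p | Q p) (dist G w p.1).+1
    ?= iff [forall (p | Q p), dist G w p.2 == (dist G w p.1).+1].
  apply: leqif_sum => -[a b] /and3P[_ _ /= ab]; split=> //; exact: dist_stepl.
rewrite L Rr (sum_outer_dist uv E) eqxx => /esym/forallP/(_ (x, y)).
by rewrite /Q /= xo yo xy => /eqP.
Qed.

(** As [u] and [v] are in turn outer for the edge [x y], [outer_square] applies to [u v] and to
    [x y] in both directions, so the distance from [w] changes equally along them. *)
Lemma lap_dist_translational : translational G.
Proof.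
apply: translational_local => // u v x uv ux dvx.
have xo : x \in outer u v by rewrite inE ux distC // dvx.
have : 0 < #|[set z in outer v u | adj G x z]| by rewrite outer_unique_nbr.
case/card_gt0P => y; rewrite inE => /andP[yo xy].
have [vy dyu] : adj G v y /\ dist G y u = 2 by move: yo; rewrite inE => /andP[-> /eqP ->].
have vu : adj G v u by rewrite adjC.
have yx : adj G y x by rewrite adjC.
have uo : u \in outer x y by rewrite inE adjC // ux distC // dyu.
have vo : v \in outer y x by rewrite inE adjC // vy dvx.
exists y => w.
have h1 := outer_square (w := w) uv xo yo xy.
have h2 := outer_square (w := w) vu yo xo yx.
have h3 := outer_square (w := w) xy uo vo uv.
have h4 := outer_square (w := w) yx vo uo vu.
case: (dist_adj_cases gG w uv) => e; case: (dist_adj_cases gG w xy) => e';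
  move: h1 h2 h3 h4 e e'; clear; lia.
Qed.

End TranslationalOfSharp.

Lemma sharp_translational (R : realType) (G : graph) : simple_connected G ->
  eff_BM_sharp G R -> translational G.
Proof.
move=> gG [K [_ HK K0 E]].
exact: (lap_dist_translational gG (sharp_lap_dist gG HK K0 E) HK).
Qed.

(** The distance from [u] is a test function for [u v] whose Laplacian difference is exactly the
    minimum [K]. *)
Lemma sharp_const_curv (R : realType) (G : graph) : simple_connected G ->
  eff_BM_sharp G R -> exists k : R, const_curv G R k.
Proof.
move=> gG [K [_ HK K0 E]]; exists K => u v uv.
have H := sharp_lap_dist gG HK K0 E; apply/eqP; rewrite eq_le HK // andbT.
have e : ((dist G u v)%:R - (dist G u u)%:R = 1 :> R)%R by rewrite dist0 // dist_adj // subr0.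
have := ocurv_le gG uv e (dist_lipschitz R gG u).
by rewrite !H dist0 // (dist_adj gG uv); lra.
Qed.

(** * The local graph determines the graph *)

Section LocalCoordinates.
Variable G : graph.
Hypotheses (gG : simple_connected G) (tG : translational G).
Variable x : vert G.
Implicit Types (y z w : vert G) (C : {set vert G}).

Definition coclique C := (forall y, y \in C -> adj G x y) /\
  (forall y z, y \in C -> z \in C -> y != z -> ~~ adj G y z).

(* [w = x + \sum_(y in C) (y - x)] *)
Definition represents C w := forall w', ((dist G w' w)%:Z =
  (dist G w' x)%:Z + \sum_(y in C) ((dist G w' y)%:Z - (dist G w' x)%:Z))%R.

Lemma coclique_dist C y z : coclique C -> y \in C -> z \in C -> y != z -> dist G y z = 2.
Proof.
move=> [a na] yC zC ne; have yx : adj G y x by rewrite adjC // a.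
by apply: (dist_eq2 gG yx (a _ zC)) => //; apply: na.
Qed.

Lemma represents_card C w : coclique C -> represents C w -> dist G x w = #|C|.
Proof.
move=> [a _] /(_ x); rewrite dist0 // add0r.
rewrite (eq_bigr (fun=> 1%R)); last by move=> y /a xy; rewrite dist_adj.
by rewrite sumr_const; lia.
Qed.

Lemma coclique_extend C y w : coclique C -> represents C w -> y \notin C ->
  coclique (y |: C) -> dist G y w = #|C|.+1.
Proof.
move=> cC rC yC cyC; have := rC y; have xy : adj G x y by apply: cyC.1; rewrite setU11.
rewrite [dist G y x]distC // (dist_adj gG xy).
rewrite (eq_bigr (fun=> 1%R)); first by rewrite sumr_const; lia.
move=> z zC; rewrite (coclique_dist cyC) ?setU11 ?setU1r //.
by apply: contraNneq yC => ->.
Qed.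

Lemma represents_setU1 C y w w' : y \notin C -> represents C w ->
  (forall v, dist G v w + dist G v y = dist G v x + dist G v w') ->
  represents (y |: C) w'.
Proof.
move=> yC rC H v; rewrite big_setU1 //= addrCA -(rC v); have := H v; lia.
Qed.

(** For the inner product [c - d] the vectors [y - x] with [y] in a coclique are pairwise
    orthogonal. So a further [y] is one step farther than [x] from the vertex [w] represented so
    far, and [w] can be translated along [x y]. *)
Lemma coclique_represents C : coclique C -> exists w, represents C w.
Proof.
move En: #|C| => n; elim: n C En => [|n IH] C' En cyC.
  by exists x => w'; rewrite (cards0_eq En) big_set0 addr0.
have [y yC'] : exists y, y \in C' by apply/card_gt0P; rewrite En.
move: En cyC; rewrite -(setD1K yC'); set C := C' :\ y => En cyC.
have yC : y \notin C by rewrite setD11.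
have cC : coclique C.
  by case: cyC => a na; split=> [z zC|z z' zC zC']; [apply: a|apply: na]; rewrite setU1r.
have [w rC] : exists w, represents C w by apply: IH => //; move: En; rewrite cardsU1 yC; case.
have xy : adj G x y by apply: cyC.1; rewrite setU11.
have E : dist G w y = (dist G w x).+1.
  by rewrite ![dist G w _]distC // (represents_card cC rC) (coclique_extend cC rC).
by have [w' H] := tG xy E; exists w'; apply: (represents_setU1 yC rC) => v; rewrite (H v).
Qed.

(** The last step [w0 w] of a geodesic from [x], translated back to [x], gives the new element [y].
    It is at distance at least 2 from each [z] in [C], because [z] is at distance [#|C| - 1] from
    [w0] and at least [#|C|] from [w]. *)
Lemma represents_exists w : exists2 C, coclique C & represents C w.
Proof.
move En: (dist G x w) => n; elim: n w En => [|n IH] w En.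
  move/eqP: En; rewrite dist_eq0 // => /eqP <-; exists set0.
    by split=> [y|y z]; rewrite inE.
  by move=> w'; rewrite big_set0 addr0.
have [w0 w0w dw0] := dist_pred gG En; have [C cC rC] := IH _ dw0.
have E : dist G x w = (dist G x w0).+1 by rewrite En dw0.
have [y Hy] := tG w0w E.
have xy := parallel_adj gG Hy E.
have far z : z \in C -> 1 < dist G z y.
  move=> zC; have xz := cC.1 z zC.
  have := Hy z; have := rC z; rewrite (bigD1 z) //= dist0 // [dist G z x]distC //.
  rewrite (dist_adj gG xz) (eq_bigr (fun=> 1%R)); last first.
    by move=> z' /andP[z'C ne]; rewrite (coclique_dist cC) // eq_sym.
  rewrite sumr_const; have -> : #|[pred i in C | i != z]| = #|C|.-1.
    by rewrite [in RHS](cardD1 z) zC /=; apply: eq_card => i; rewrite !inE andbC.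
  have : 0 < #|C| by apply/card_gt0P; exists z.
  have := dist_triangle gG x z w; have := dist_triangle gG z x w.
  rewrite (dist_adj gG xz) [dist G z x]distC // (dist_adj gG xz) E.
  by rewrite (represents_card cC rC); lia.
have yC : y \notin C by apply/negP => /far; rewrite dist0.
exists (y |: C).
  split=> [z|z z']; rewrite !in_setU1; first by case/predU1P => [->|/cC.1].
  case/predU1P => [->|zC]; case/predU1P => [->|z'C]; rewrite ?eqxx // => ne.
  - by rewrite adjC // -(dist_eq1 gG); have := far _ z'C; lia.
  - by rewrite -(dist_eq1 gG); have := far _ zC; lia.
  - exact: cC.2.
by apply: (represents_setU1 yC rC) => v; have := Hy v; lia.
Qed.

(** Bilinear expansion: only distances between neighbours of [x] enter, and these are 0, 1 or 2 as
    the local graph decides. *)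
Lemma represents_dist C C' w w' : coclique C -> coclique C' ->
  represents C w -> represents C' w' ->
  ((dist G w w')%:Z = #|C|%:Z + #|C'|%:Z +
     \sum_(y in C) \sum_(z in C') ((dist G y z)%:Z - 2))%R.
Proof.
move=> cC cC' rC rC'; rewrite distC // (rC w') [dist G w' x]distC //.
rewrite (represents_card cC' rC') [RHS]addrAC [RHS]addrC; congr (_ + _)%R.
rewrite -[Posz #|C|]natz -[in #|C|]sum1_card natr_sum -big_split /=; apply: eq_bigr => y yC.
have xy := cC.1 y yC; rewrite distC // (rC' y) [dist G y x]distC // (dist_adj gG xy).
rewrite !sumrB !sumr_const; lia.
Qed.

End LocalCoordinates.

Section LocalDeterminesGlobal.
Variables G G' : graph.
Hypotheses (gG : simple_connected G) (tG : translational G).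
Hypotheses (gG' : simple_connected G') (tG' : translational G').
Variables (x : vert G) (x' : vert G') (f : vert G -> vert G').
Hypothesis f_nbr : forall y, adj G x y -> adj G' x' (f y).
Hypothesis f_onto : forall y', adj G' x' y' -> exists2 y, adj G x y & f y = y'.
Hypothesis f_inj : forall y z, adj G x y -> adj G x z -> f y = f z -> y = z.
Hypothesis f_adj : forall y z, adj G x y -> adj G x z -> adj G' (f y) (f z) = adj G y z.

Lemma local_iso_dist y z : adj G x y -> adj G x z -> dist G' (f y) (f z) = dist G y z.
Proof.
move=> xy xz; have [->|ne] := eqVneq y z; first by rewrite !dist0.
have ne' : f y != f z by apply: contra_neq ne; exact: f_inj.
case: (boolP (adj G y z)) => yz; first by rewrite !dist_adj ?f_adj.
have yx : adj G y x by rewrite adjC.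
have yx' : adj G' (f y) x' by rewrite adjC // f_nbr.
by rewrite (dist_eq2 gG yx xz) // (dist_eq2 gG' yx' (f_nbr xz)) // f_adj.
Qed.

Lemma coclique_imset C : coclique x C -> coclique x' (f @: C).
Proof.
move=> [a na]; split=> [_ /imsetP[y yC ->]|]; first exact/f_nbr/a.
move=> _ _ /imsetP[y yC ->] /imsetP[z zC ->] ne; rewrite f_adj ?a //.
by apply: na => //; apply: contra_neq ne => ->.
Qed.

(** [F] is built from an arbitrary choice of cocliques. [FD] shows that distances between images do
    not depend on that choice, so [F] is an isometry; it is onto because cocliques of [G'] at [x']
    lift through [f]. *)
Lemma local_iso : iso G G'.
Proof.
have /fin_all_exists [F HF] : forall w, exists w', exists C,
    [/\ coclique x C, represents x C w & represents x' (f @: C) w'].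
  move=> w; have [C cC rC] := represents_exists gG tG x w.
  by have [w' rw'] := coclique_represents gG' tG' (coclique_imset cC); exists w', C.
have FD C C' w w' v v' : coclique x C -> coclique x C' ->
    represents x C w -> represents x C' w' ->
    represents x' (f @: C) v -> represents x' (f @: C') v' -> dist G' v v' = dist G w w'.
  move=> cC cC' rC rC' rv rv'; suff : Posz (dist G' v v') = Posz (dist G w w') by case.
  have cf := coclique_imset cC; have cf' := coclique_imset cC'.
  have injC D : coclique x D -> {in D &, injective f}.
    by move=> [a _] y z yD zD; apply: f_inj; apply: a.
  have := represents_dist gG tG cC cC' rC rC'; have := represents_dist gG' tG' cf cf' rv rv'.
  rewrite !card_in_imset ?big_imset //=; try exact: injC.
  under eq_bigr => y yC.
    rewrite big_imset /=; last exact: injC.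
    under eq_bigr => z zC do rewrite local_iso_dist ?(cC.1 y) ?(cC'.1 z) //.
    over.
  by move=> -> ->.
have isoF w w' : dist G' (F w) (F w') = dist G w w'.
  by have [C [c r r']] := HF w; have [D [d s s']] := HF w'; apply: (FD C D).
have injF : injective F.
  by move=> w w' e; apply/eqP; rewrite -(dist_eq0 gG) -isoF e dist0.
have /fin_all_exists [g Hg] : forall w', exists w, F w = w'.
  move=> w'; have [C' cC' rC'] := represents_exists gG' tG' x' w'.
  have CE : C' = f @: [set y | adj G x y && (f y \in C')].
    apply/setP => z; apply/idP/imsetP => [zC|[y]]; last by rewrite inE => /andP[_ h] ->.
    have [y xy fy] := f_onto (cC'.1 z zC); exists y => //.
    by rewrite inE xy fy.
  set C := [set y | _] in CE.
  have cC : coclique x C.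
    split=> [y|y z]; first by rewrite inE => /andP[].
    rewrite !inE => /andP[xy yC] /andP[xz zC] ne; rewrite -f_adj //; apply: cC'.2 => //.
    by apply: contra_neq ne; apply: f_inj.
  have [w rw] := coclique_represents gG tG cC; exists w.
  have [D [cD rD rD']] := HF w; apply/eqP; rewrite -(dist_eq0 gG').
  by rewrite (FD D C w w) ?dist0 // -CE.
exists F; split; last by move=> w w'; rewrite -(dist_eq1 gG) -(dist_eq1 gG') isoF.
by exists g => // w; apply: injF.
Qed.

End LocalDeterminesGlobal.

(** * Components of the local graph *)

Definition tgraph (G : graph) := simple_connected G /\ translational G.

Lemma tgraphP (G : graph) (del : vert G -> vert G -> nat) :
  simple_graph G ->
  (forall x, del x x = 0) -> (forall x y, del x y = 0 -> x = y) ->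
  (forall x y z, adj G y z -> del x z <= (del x y).+1) ->
  (forall x y n, del x y = n.+1 -> exists2 z, adj G z y & del x z = n) ->
  (forall u v x, adj G u v -> del x v = (del x u).+1 ->
     exists y, forall w, del w x + del w v = del w u + del w y) ->
  tgraph G /\ forall x y, dist G x y = del x y.
Proof.
move=> sG d0 dI dS dP dT; have [gG dE] := dist_unique sG d0 dI dS dP.
split=> //; split=> // u v x uv; rewrite !dE => /(dT _ _ _ uv)[y Hy].
by exists y => w; rewrite !dE Hy.
Qed.

Lemma tgraph_iso (G G' : graph) : iso G G' -> tgraph G' -> tgraph G.
Proof.
move=> [f [[g fK gK] fadj]] [gG tG].
have hg y z : adj G y (g z) = adj G' (f y) z by rewrite -fadj gK.
case: (@tgraphP G (fun x y => dist G' (f x) (f y))) => //.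
- split=> [x y|x]; first by rewrite -!fadj adjC.
  by rewrite -fadj adj_irr.
- by move=> x; rewrite dist0.
- by move=> x y /eqP; rewrite dist_eq0 // => /eqP/(can_inj fK).
- by move=> x y z yz; apply: dist_stepl => //; rewrite fadj.
- move=> x y n /(dist_pred gG)[z zy dz]; exists (g z); last by rewrite gK.
  by rewrite -fadj gK.
- move=> u v x uv E; rewrite -fadj in uv; have [y Hy] := tG _ _ _ uv E.
  by exists (g y) => w; rewrite gK.
Qed.

Lemma tgraph_dist_cart (G1 G2 : graph) : tgraph G1 -> tgraph G2 -> tgraph (cart G1 G2) /\
  forall p q, dist (cart G1 G2) p q = dist G1 p.1 q.1 + dist G2 p.2 q.2.
Proof.
move=> [g1 t1] [g2 t2].
apply: (@tgraphP (cart G1 G2) (fun p q => dist G1 p.1 q.1 + dist G2 p.2 q.2)).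
- split=> [[a b] [c d]|[a b]] /=; last by rewrite !adj_irr // andbF.
  by rewrite /= (adjC g1 a) (adjC g2 b) (eq_sym a) (eq_sym b).
- by move=> [a b]; rewrite !dist0.
- move=> [a b] [c d] /eqP /=; rewrite addn_eq0 !dist_eq0 //.
  by case/andP => /eqP -> /eqP ->.
- move=> [a b] [c d] [c' d'] /= /orP[]/andP[].
    by move/eqP => <- e; have := dist_stepl g2 b e; lia.
  by move=> e /eqP <-; have := dist_stepl g1 a e; lia.
- move=> [a b] [c d] n /= E.
  case Ea: (dist G1 a c) => [|m].
    have Eb : dist G2 b d = n.+1 by lia.
    have [z zd dz] := dist_pred g2 Eb; exists (c, z); rewrite /= ?eqxx ?zd //; lia.
  have [z zd dz] := dist_pred g1 Ea; exists (z, d); rewrite /= ?eqxx ?zd ?orbT //; lia.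
- move=> [u u'] [v v'] [x x'] /= /orP[]/andP[].
    move/eqP => <- e E; have E' : dist G2 x' v' = (dist G2 x' u').+1 by lia.
    by have [y Hy] := t2 _ _ _ e E'; exists (x, y) => -[w w'] /=; have := Hy w'; lia.
  move=> e /eqP <- E; have E' : dist G1 x v = (dist G1 x u).+1 by lia.
  by have [y Hy] := t1 _ _ _ e E'; exists (y, x') => -[w w'] /=; have := Hy w; lia.
Qed.

Lemma tgraph_cart (G1 G2 : graph) : tgraph G1 -> tgraph G2 -> tgraph (cart G1 G2).
Proof. by move=> g1 g2; case: (tgraph_dist_cart g1 g2). Qed.

Definition induced (G : graph) (C : {set vert G}) : graph :=
  @Graph {z : vert G | z \in C} (fun a b => adj G (val a) (val b)).

Section LocalComponents.
Variable G : graph.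
Hypotheses (gG : simple_connected G) (tG : translational G).
Variable x : vert G.
Implicit Types a b p q y z : vert G.

(** For neighbours of [x]: distance at most 2 within the local graph. There it turns out to be an
    equivalence relation, whose classes are the components. *)
Definition near a b :=
  [|| a == b, adj G a b | [exists p, [&& adj G x p, adj G a p & adj G p b]]].

Lemma nearC a b : near a b = near b a.
Proof.
rewrite /near eq_sym adjC //; congr [|| _, _ | _].
by apply: eq_existsb => p; rewrite (adjC gG a) (adjC gG p b) [adj G p a && _]andbC.
Qed.

(* A path [y, a, b, q] in the neighbourhood of [x] is shortened by the vertex
   [y - a + b]. *)
Lemma near_path y a b q : adj G x y -> adj G x a -> adj G x b -> adj G x q ->
  adj G y a -> adj G a b -> adj G b q -> near y q.
Proof.
move=> xy xa xb xq ya ab bq; rewrite /near.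
have [//|nyq] /= := eqVneq y q; case: (boolP (adj G y q)) => //= ayq.
apply/existsP; case: (boolP (adj G y b)) => [yb|ayb]; first by exists b; rewrite xb yb.
case: (boolP (adj G a q)) => [aq|aaq]; first by exists a; rewrite xa ya.
have nyb : y != b by apply: contraNneq ayq => ->.
have naq : a != q by apply: contraNneq ayq => <-.
have yx : adj G y x by rewrite adjC.
have dyb := dist_eq2 gG ya ab nyb ayb.
have daq := dist_eq2 gG ab bq naq aaq.
have dyq := dist_eq2 gG yx xq nyq ayq.
have [p Hp] : exists p, parallel a y b p.
  by apply: tG; rewrite ?[dist G b _]distC // ?dyb ?(dist_adj gG ab) // adjC.
have e1 : dist G x p = 1.
  by have := Hp x; rewrite (dist_adj gG xb) (dist_adj gG xy) (dist_adj gG xa) => /(@addnI 1 1).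
have e2 : dist G y p = 1.
  by have := Hp y; rewrite dyb dist0 // (dist_adj gG ya) => /(@addnI 1 1).
have e3 : dist G p q = 1.
  have := Hp q; rewrite ![dist G q _]distC // (dist_adj gG bq) dyq daq.
  by move/(@addnI 2 1).
by exists p; rewrite -!(dist_eq1 gG) e1 e2 e3.
Qed.

Lemma near_step y a b : adj G x y -> adj G x a -> adj G x b ->
  near y a -> adj G a b -> near y b.
Proof.
move=> xy xa xb + ab; rewrite {1}/near => /or3P[/eqP ->|ya|/existsP[p /and3P[xp yp pa]]].
- by rewrite /near ab orbT.
- by rewrite /near; apply/or3P/Or33/existsP; exists a; rewrite xa ya.
- exact: (near_path xy xp xa xb yp pa ab).
Qed.

Lemma near_trans y a b : adj G x y -> adj G x a -> adj G x b ->
  near y a -> near a b -> near y b.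
Proof.
move=> xy xa xb ya; rewrite {1}/near => /or3P[/eqP <- //|ab|/existsP[p /and3P[xp ap pb]]].
  exact: near_step ya ab.
exact: (near_step xy xp xb (near_step xy xa xp ya ap) pb).
Qed.

Variable y0 : vert G.
Hypothesis xy0 : adj G x y0.

Definition local_component := [set z | adj G x z && near y0 z].

Lemma local_component_step a b : a \in local_component -> adj G x b -> adj G a b ->
  b \in local_component.
Proof.
by rewrite !inE => /andP[xa na] xb ab; rewrite xb; apply: near_step na ab.
Qed.

Lemma local_component_near a b : a \in local_component -> b \in local_component -> near a b.
Proof.
rewrite !inE => /andP[xa na] /andP[xb nb].
by apply: (near_trans _ xy0) => //; rewrite nearC.
Qed.

Lemma local_component_diam (a b : vert (induced local_component)) :
  [|| a == b, adj _ a b | [exists p, adj _ a p && adj _ p b]].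
Proof.
case: a b => [a aC] [b bC]; have := local_component_near aC bC.
case/or3P => [ab|ab|/existsP[p /and3P[xp ap pb]]].
- by apply/or3P/Or31.
- by apply/or3P/Or32.
- apply/or3P/Or33/existsP; have pC := local_component_step aC xp ap.
  by exists (exist _ p pC); rewrite /= ap.
Qed.

(** Diameter 2 makes the distance of the component the restriction of that of [G]. A translate taken
    in [G] stays in the component: its identity, read at [x], puts it at distance 1 from [x]. *)
Lemma tgraph_local_component : tgraph (induced local_component).
Proof.
case: (@tgraphP (induced local_component) (fun a b : vert (induced local_component) => dist G (val a) (val b))) => //.
- by split=> [a b|a] /=; rewrite ?adj_irr // adjC.
- by move=> a; rewrite dist0.
- by move=> a b /eqP; rewrite dist_eq0 // => /eqP/val_inj.
- by move=> a b c bc; apply: dist_stepl.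
- move=> a b n E; case/or3P: (local_component_diam a b) => [/eqP e|ab|/existsP[p /andP[ap pb]]].
  + by move: E; rewrite e dist0.
  + by exists a => //; move: E; rewrite (dist_adj gG ab) dist0 // => -[].
  + have := dist_triangle gG (val p) (val a) (val b).
    rewrite (dist_adj gG ap) (dist_adj gG pb) E => l.
    case: n E l => [/eqP|[|//]] E _; last by exists p; rewrite // dist_adj.
    by rewrite dist_eq1 // in E; exists a; rewrite ?dist0.
- move=> u v a uv E; have [y Hy] := tG uv E; have ay := parallel_adj gG Hy E.
  have xN (c : vert (induced local_component)) : adj G x (val c).
    by move: (valP c); rewrite inE => /andP[].
  have xy : adj G x y.
    by rewrite -(dist_eq1 gG); have := Hy x; rewrite !(dist_adj gG (xN _)); lia.
  by exists (exist _ y (local_component_step (valP a) xy ay)) => w; apply: Hy.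
Qed.

End LocalComponents.

(** * Johnson graphs *)

Lemma tgraph_complete (G : graph) : (forall x y : vert G, adj G x y = (x != y)) -> tgraph G.
Proof.
move=> aE; case: (@tgraphP G (fun x y => (x != y) : nat)) => //.
- by split=> [x y|x]; rewrite !aE 1?eq_sym ?eqxx.
- by move=> x; rewrite eqxx.
- by move=> x y; have [->|] := eqVneq x y.
- by move=> x y z _; case: (x != z).
- move=> x y [|n]; have [//|ne] := eqVneq x y => // _; exists x; rewrite ?aE ?eqxx //.
- move=> u v x _; have [->|] := eqVneq x u; first by exists v => w; rewrite addnC.
  by case: (x != v).
Qed.

Section SetCounting.
Variable T : finType.
Implicit Types A B X Y U V W : {set T}.

Lemma card_setD_sum A B : #|A :\: B| = \sum_i ((i \in A) && (i \notin B)).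
Proof.
by rewrite -sum1_card big_mkcond /=; apply: eq_bigr => i _; rewrite inE andbC; case: ifP.
Qed.

Definition symdiff A B := (A :\: B) :|: (B :\: A).

Lemma in_symdiff A B i : (i \in symdiff A B) = (i \in A) (+) (i \in B).
Proof. by rewrite !inE; case: (i \in A); case: (i \in B). Qed.

Lemma symdiffC A B : symdiff A B = symdiff B A.
Proof. exact: setUC. Qed.

Lemma card_symdiff_sum A B : #|symdiff A B| = \sum_i ((i \in A) (+) (i \in B)).
Proof.
rewrite -sum1_card big_mkcond /=; apply: eq_bigr => i _; rewrite in_symdiff; case: ifP => //.
Qed.

Lemma card_symdiff A B : #|symdiff A B| = #|A :\: B| + #|B :\: A|.
Proof.
rewrite card_symdiff_sum !card_setD_sum -big_split /=; apply: eq_bigr => i _.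
by case: (i \in A); case: (i \in B).
Qed.

Lemma odd_symdiff A B : odd #|symdiff A B| = odd #|A| (+) odd #|B|.
Proof.
have -> : odd #|A| = odd (#|A :&: B| + #|A :\: B|) by rewrite cardsID.
have -> : odd #|B| = odd (#|A :&: B| + #|B :\: A|) by rewrite setIC cardsID.
by rewrite card_symdiff !oddD; do 3 case: (odd _).
Qed.

Lemma card_setD_eq A B : #|A| = #|B| -> #|A :\: B| = #|B :\: A|.
Proof. by move=> e; have := cardsID B A; have := cardsID A B; rewrite setIC; lia. Qed.

Lemma card_exchange A i j : i \in A -> j \notin A -> #|j |: (A :\ i)| = #|A|.
Proof.
move=> iA jA; rewrite cardsU1 !inE (negPf jA) andbF /=.
by rewrite [in RHS](cardsD1 i) iA.
Qed.

Lemma exchange_of_card A B : #|A| = #|B| -> #|A :\: B| = 1 ->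
  exists i j, [/\ i \in A, j \notin A & B = j |: (A :\ i)].
Proof.
move=> e c; have c' := card_setD_eq e; rewrite c in c'.
have /cards1P[i Ei] : #|A :\: B| == 1 by rewrite c.
have /cards1P[j Ej] : #|B :\: A| == 1 by rewrite -c'.
have hi k : (k \notin B) && (k \in A) = (k == i) by rewrite -in_setD Ei inE.
have hj k : (k \notin A) && (k \in B) = (k == j) by rewrite -in_setD Ej inE.
exists i, j; split.
- by have := hi i; rewrite eqxx => /andP[].
- by have := hj j; rewrite eqxx => /andP[].
- apply/setP => k; rewrite !inE -hi -hj.
  by case: (k \in A); case: (k \in B).
Qed.

End SetCounting.

Section Johnson.
Variables n k : nat.
Hypothesis k_gt0 : 0 < k.
Notation J := (johnson n k).
Implicit Types A B U V W X : vert J.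

Lemma card_johnson A : #|val A| = k. Proof. exact/eqP/(valP A). Qed.

Lemma johnson_adj A B : adj J A B = (#|val A :\: val B| == 1).
Proof.
rewrite /=; have := cardsID (val B) (val A); rewrite card_johnson.
by move: #|_ :&: _| #|_ :\: _| => a b; have := k_gt0; lia.
Qed.

Lemma johnson_exchange A i j : i \in val A -> j \notin val A ->
  exists2 B, adj J A B & val B = j |: (val A :\ i).
Proof.
move=> iA jA; have cB : #|j |: (val A :\ i)| == k by rewrite card_exchange // card_johnson.
exists (exist (fun D : {set 'I_n} => #|D| == k) _ cB) => //; rewrite johnson_adj /=.
apply/cards1P; exists i; apply/setP => l; rewrite !inE.
have [->|ne] := eqVneq l i; first by rewrite iA orbF andbT; apply: contraNneq jA => <-.
by case: (l == j); case: (l \in val A).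
Qed.

Lemma johnson_nbr A B : adj J A B ->
  exists i j, [/\ i \in val A, j \notin val A & val B = j |: (val A :\ i)].
Proof.
by rewrite johnson_adj => /eqP; apply: exchange_of_card; rewrite !card_johnson.
Qed.

Lemma johnson_setDC A B : #|val A :\: val B| = #|val B :\: val A|.
Proof. by apply: card_setD_eq; rewrite !card_johnson. Qed.

(** The edge exchanges [i] for [j]. That [X] is nearer to [U] means that [X] contains [i] and not
    [j], and the same exchange in [X] gives the translate; counted element by element, the identity
    holds termwise. *)
Lemma tgraph_dist_johnson : tgraph J /\ forall A B, dist J A B = #|val A :\: val B|.
Proof.
apply: (@tgraphP J (fun A B : vert J => #|val A :\: val B|)).
- split=> [A B|A]; last by rewrite johnson_adj setDv cards0.
  by rewrite !johnson_adj johnson_setDC.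
- by move=> A; rewrite setDv cards0.
- move=> A B /eqP; rewrite cards_eq0 setD_eq0 => sAB; apply: val_inj; apply/eqP.
  by rewrite eqEcard sAB !card_johnson leqnn.
- move=> A B C; rewrite johnson_adj => /eqP c; rewrite -addn1 -c.
  apply: leq_trans (leq_card_setU _ _); apply/subset_leq_card/subsetP => i.
  by rewrite !inE; case: (i \in val A); case: (i \in val B); case: (i \in val C).
- move=> A B m E.
  have /card_gt0P[i] : 0 < #|val A :\: val B| by rewrite E.
  have /card_gt0P[j] : 0 < #|val B :\: val A|.
    by rewrite johnson_setDC E.
  rewrite !inE => /andP[jA jB] /andP[iB iA].
  have [C BC EC] := johnson_exchange jB iB; exists C.
    by rewrite johnson_adj johnson_setDC -johnson_adj.
  have -> : val A :\: val C = (val A :\: val B) :\ i.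
    apply/setP => l; rewrite EC !inE; have [->|ne] := eqVneq l j.
      by rewrite (negPf jA) !andbF.
    by case: (l == i).
  by have := cardsD1 i (val A :\: val B); rewrite E inE iB iA add1n => -[].
- move=> U V X /johnson_nbr[i [j [iU jU EV]]] E.
  have ij : (i == j) = false by apply: contraNF jU => /eqP <-.
  have S1 l0 (b : bool) : \sum_(l < n) ((l == l0) && b) = b.
    by rewrite (bigD1 l0) //= eqxx big1 ?addn0 // => l /negPf ->.
  have h : #|val X :\: val V| + (j \in val X) = #|val X :\: val U| + (i \in val X).
    rewrite !card_setD_sum -(S1 j (j \in val X)) -(S1 i (i \in val X)) -!big_split /=.
    apply: eq_bigr => l _; rewrite EV !inE.
    have [->|li] := eqVneq l i; first by rewrite ij iU /=; case: (i \in _).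
    have [->|lj] := eqVneq l j; first by rewrite (negPf jU) /=; case: (j \in _).
    by rewrite !addn0.
  have {h} [iX jX] : i \in val X /\ j \notin val X.
    by move: h; rewrite E; case: (i \in val X); case: (j \in val X) => //=; lia.
  have [Y _ EY] := johnson_exchange iX jX; exists Y => W.
  rewrite !card_setD_sum -!big_split /=; apply: eq_bigr => l _.
  rewrite EV EY !inE; have [->|li] := eqVneq l i.
    by rewrite ij iU iX /=; case: (i \in _).
  have [->|lj] := eqVneq l j; first by rewrite (negPf jU) (negPf jX) /=; case: (j \in _).
  by rewrite /= addnC.
Qed.

End Johnson.

(** * Halved cubes, cocktail party graphs, Schlafli graphs *)

Section HalvedCube.
Variable n : nat.
Notation H := (halved_cube n).
Implicit Types A B U V W X : vert H.

Lemma halved_cube_adj A B : adj H A B = (#|symdiff (val A) (val B)| == 2).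
Proof. by []. Qed.

Lemma halved_cube_even A : odd #|val A| = false.
Proof. exact/negbTE/(valP A). Qed.

Lemma card_symdiff_half A B :
  #|symdiff (val A) (val B)| = (#|symdiff (val A) (val B)|./2).*2.
Proof. by rewrite -[LHS]odd_double_half odd_symdiff !halved_cube_even. Qed.

Lemma halved_cube_flip A (i j : 'I_n) : i != j ->
  exists2 B, adj H A B & val B = symdiff (val A) [set i; j].
Proof.
move=> ij; have eB : ~~ odd #|symdiff (val A) [set i; j]|.
  by rewrite odd_symdiff halved_cube_even cards2 ij.
exists (exist (fun D : {set 'I_n} => ~~ odd #|D|) _ eB) => //; rewrite halved_cube_adj /=.
have -> : symdiff (val A) (symdiff (val A) [set i; j]) = [set i; j].
  by apply/setP => l; rewrite !in_symdiff addbA addbb.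
by rewrite cards2 ij.
Qed.

Lemma halved_cube_nbr A B : adj H A B ->
  exists i j, i != j /\ val B = symdiff (val A) [set i; j].
Proof.
rewrite halved_cube_adj => /cards2P[i [j [ij E]]]; exists i, j; split=> //.
by rewrite -E; apply/setP => l; rewrite !in_symdiff addbA addbb.
Qed.

(** The edge flips [i] and [j]. That [X] is nearer to [U] forces [X] and [U] to agree at both, and
    flipping them in [X] gives the translate. Doubling removes the halves. *)
Lemma tgraph_dist_halved_cube :
  tgraph H /\ forall A B, dist H A B = #|symdiff (val A) (val B)|./2.
Proof.
apply: (@tgraphP H (fun A B : vert H => #|symdiff (val A) (val B)|./2)).
- split=> [A B|A]; first by rewrite !halved_cube_adj symdiffC.
  by rewrite halved_cube_adj /symdiff setDv setU0 cards0.
- by move=> A; rewrite /symdiff setDv setU0 cards0.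
- move=> A B h; have := card_symdiff_half A B; rewrite h => /eqP.
  rewrite cards_eq0 => /eqP E; apply/val_inj/setP => i.
  by have := in_symdiff (val A) (val B) i; rewrite E inE; case: (_ \in _); case: (_ \in _).
- move=> A B C; rewrite halved_cube_adj => /eqP c.
  rewrite -leq_double doubleS -!card_symdiff_half -addn2 -c !card_symdiff_sum -big_split /=.
  by apply: leq_sum => i _; do 3 case: (i \in _).
- move=> A B m E; have E2 := card_symdiff_half A B; rewrite E in E2.
  have /card_gt0P[i iAB] : 0 < #|symdiff (val A) (val B)| by rewrite E2.
  have /card_gt0P[j] : 0 < #|symdiff (val A) (val B) :\ i|.
    by have := cardsD1 i (symdiff (val A) (val B)); rewrite iAB E2; lia.
  rewrite in_setD1 => /andP[ji jAB].
  have [C BC EC] := halved_cube_flip B ji; exists C.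
    by rewrite halved_cube_adj symdiffC.
  have -> : symdiff (val A) (val C) = symdiff (val A) (val B) :\ i :\ j.
    apply/setP => l; rewrite EC !in_setD1 !in_symdiff !inE.
    have [->|lj] := eqVneq l j; first by move: jAB; rewrite in_symdiff; do 2 case: (_ \in _).
    have [->|li] := eqVneq l i; first by move: iAB; rewrite in_symdiff; do 2 case: (_ \in _).
    by rewrite /= addbF.
  have := cardsD1 i (symdiff (val A) (val B)).
  by rewrite iAB E2 (cardsD1 j (_ :\ i)) in_setD1 ji jAB /= doubleS !add1n => -[<-]; rewrite doubleK.
- move=> U V X /halved_cube_nbr[i [j [ij EV]]] E.
  have {E} E : #|symdiff (val X) (val V)| = #|symdiff (val X) (val U)| + 2.
    by rewrite (card_symdiff_half X V) E doubleS -card_symdiff_half addn2.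
  have S1 l0 (b : nat) : \sum_(l < n) (if l == l0 then b else 0) = b.
    by rewrite -big_mkcond big_pred1_eq.
  pose c l : nat := (l \in val X) (+) (l \in val U).
  have h : #|symdiff (val X) (val V)| + \sum_l (if l == i then c i * 2 else 0)
        + \sum_l (if l == j then c j * 2 else 0) =
      #|symdiff (val X) (val U)| + \sum_l (if l == i then 1 else 0) + \sum_l (if l == j then 1 else 0).
    rewrite !card_symdiff_sum -!big_split /=; apply: eq_bigr => l _.
    rewrite EV in_symdiff !inE /c.
    have [->|li] := eqVneq l i; first by rewrite (negPf ij) /=; do 2 case: (_ \in _).
    have [->|lj] := eqVneq l j; first by rewrite /=; do 2 case: (_ \in _).
    by rewrite /= addbF.
  have {h} [hi hj] : c i = 0 /\ c j = 0.
    move: h; rewrite !S1 E; move: #|_| (c i) (c j) => a b d; clear; lia.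
  have iX : (i \in val X) = (i \in val U).
    by move: hi; rewrite /c; do 2 case: (_ \in _).
  have jX : (j \in val X) = (j \in val U).
    by move: hj; rewrite /c; do 2 case: (_ \in _).
  have [Y _ EY] := halved_cube_flip X ij; exists Y => W.
  apply: double_inj; rewrite !doubleD -!card_symdiff_half !card_symdiff_sum -!big_split /=.
  apply: eq_bigr => l _; rewrite EV EY !in_symdiff !inE.
  have [->|li] := eqVneq l i; first by rewrite iX.
  have [->|lj] := eqVneq l j; first by rewrite jX.
  by rewrite /= !addbF addnC.
Qed.

End HalvedCube.

Lemma tgraph_cocktail k : 1 < k -> tgraph (cocktail k).
Proof.
move=> k1; pose del (p q : vert (cocktail k)) := if p == q then 0 else if p.2 == q.2 then 2 else 1.
have sC : simple_graph (cocktail k) by split=> [p q|p]; rewrite /= 1?eq_sym ?eqxx.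
have [gC dE] : simple_connected (cocktail k) /\ forall p q, dist _ p q = del p q.
  apply: dist_unique => //.
  - by move=> p; rewrite /del eqxx.
  - by move=> p q; rewrite /del; case: eqVneq => // _; case: ifP.
  - move=> p q r /= qr; rewrite /del; case: (eqVneq p r) => // ne.
    case: (eqVneq p.2 r.2) => // e; case: (eqVneq p q) => [pq|_]; last by case: ifP.
    by move: qr; rewrite -pq e eqxx.
  - move=> [b i] [c j] m; rewrite /del; case: eqVneq => // ne /=; case: eqVneq => [e|ij] [<-].
      have [l il] : exists l : 'I_k, l != i.
        have [i0|i0] := eqVneq (i : nat) 0; last first.
          by exists (Ordinal (ltnW k1)); rewrite -val_eqE eq_sym.
        by exists (Ordinal k1); rewrite -val_eqE /= i0.
      exists (true, l); rewrite /= -?e //; case: eqVneq => [[_ e']|]; first by rewrite e' eqxx in il.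
      by rewrite [i == l]eq_sym (negPf il).
    by exists (b, i); rewrite ?eqxx.
split=> //; apply: translational_local => // u v x uv ux; rewrite dE /del.
case: eqVneq => // vx; case: eqVneq => // e _.
(* [v] and [x] are antipodal, and the distances from any vertex to an antipodal pair sum to 2; so
   the antipode of [u] is the translate. *)
exists (~~ u.1, u.2) => w; rewrite !dE /del.
move: u v x w uv ux vx e => [a i] [b j] [c l] [d m] /= ij il vx e.
subst l; move: vx; rewrite !xpair_eqE eqxx andbT.
have [->|mj] := eqVneq m j; rewrite ?andbT ?andbF.
  by rewrite [j == i]eq_sym (negPf ij) !andbF; case: b; case: c; case: d.
by case: (m == i); rewrite ?andbT ?andbF //; case: a; case: d.
Qed.

(* In the complement, nonadjacent pairs span lines of three points and every
   vertex off a line is collinear with exactly one of its points, so distances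
   to the points of a line sum to 4. *)
Lemma tgraph_srg (G : graph) : schlafli G -> tgraph G.
Proof.
case=> sG cV regG lam mu.
have adjS x y : adj G x y = adj G y x by case: sG => s _; rewrite s.
have irr x : adj G x x = false by case: sG => _ ->.
have cN x : #|[set z | adj G x z]| = 16.
  rewrite -(regG x); apply: eq_card => y; rewrite inE; apply/idP/idP => [a|/set_mem //].
  exact/mem_set.
have cI x y : x != y -> ~~ adj G x y -> #|[set z | adj G x z] :&: [set z | adj G y z]| = 8.
  by move=> ne na; rewrite -(mu x y ne na); apply: eq_card => z; rewrite !inE.
have conn : connected G.
  move=> x y; have [->|ne] := eqVneq x y; first exact: connect0.
  case: (boolP (adj G x y)) => [|na]; first exact: connect1.
  have : 0 < #|[set z | adj G x z && adj G y z]| by rewrite mu.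
  case/card_gt0P => z; rewrite inE => /andP[xz yz].
  by apply: (connect_trans (connect1 xz)); apply: connect1; rewrite adjS.
have gG : simple_connected G by [].
have d2 x y : x != y -> ~~ adj G x y -> dist G x y = 2.
  move=> ne na; have : 0 < #|[set z | adj G x z && adj G y z]| by rewrite mu.
  case/card_gt0P => z; rewrite inE => /andP[xz yz].
  by apply: (@dist_eq2 _ gG x z y) => //; rewrite adjS.
(* Adjacency in the complement: valency 27 - 1 - 16 = 10, and a far pair has 27 - 2 - (16 + 16 - 8)
   = 1 common far vertex, the third point of its line. *)
pose far x := [set z | (z != x) && ~~ adj G x z].
have farC x y : (x \in far y) = (y \in far x) by rewrite !inE eq_sym adjS.
have c_far x : #|far x| = 10.
  have : #|~: (x |: [set z | adj G x z])| = 10.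
    by have := cardsC (x |: [set z | adj G x z]); rewrite cardsU1 cN inE irr cV /=; lia.
  by move=> <-; apply: eq_card => z; rewrite !inE negb_or.
have third x y : y \in far x -> #|far x :&: far y| = 1.
  rewrite inE => /andP[yx nxy].
  set X := [set z | adj G x z]; set Y := [set z | adj G y z].
  have cU : #|X :|: Y| = 24 by have := cardsUI X Y; rewrite cI 1?eq_sym // !cN; lia.
  have : #|~: (x |: (y |: (X :|: Y)))| = 1.
    have := cardsC (x |: (y |: (X :|: Y))); rewrite !cardsU1 cU !inE !irr cV.
    by rewrite [adj G y x]adjS (negPf nxy) eq_sym (negPf yx) /=; lia.
  move=> <-; apply: eq_card => z; rewrite !inE !negb_or.
  by case: (z == x); case: (z == y); case: (adj G x z); case: (adj G y z).
have line x y z w : y \in far x -> z \in far x -> z \in far y ->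
    dist G w x + dist G w y + dist G w z = 4.
  move=> xy xz yz.
  have uniq3 a b c d : b \in far a -> c \in far a -> c \in far b -> d \in far a ->
      d \in far b -> d = c.
    move=> ab ac bc ad bd; have /eqP/cards1P[e E] := third _ _ ab.
    have : d \in far a :&: far b by rewrite inE ad.
    have : c \in far a :&: far b by rewrite inE ac.
    by rewrite E !inE => /eqP -> /eqP ->.
  have fd a b : b \in far a -> dist G b a = 2.
    by rewrite inE => /andP[ne na]; apply: d2 => //; rewrite adjS.
  have fd' a b : b \in far a -> dist G a b = 2 by move=> h; apply: fd; rewrite farC.
  have [->|wx] := eqVneq w x; first by rewrite dist0 // (fd' _ _ xy) (fd' _ _ xz).
  have [->|wy] := eqVneq w y; first by rewrite dist0 // (fd _ _ xy) (fd' _ _ yz).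
  have [->|wz] := eqVneq w z; first by rewrite dist0 // (fd _ _ xz) (fd _ _ yz).
  have dE a : w != a -> dist G w a = 1 + (w \in far a).
    move=> wa; case: (boolP (w \in far a)) => [/fd -> //|].
    by rewrite inE wa negbK => aw; rewrite dist_adj // adjS.
  rewrite !dE //.
  have nxy : ~~ ((w \in far x) && (w \in far y)).
    by apply/negP => /andP[a b]; case/eqP: wz; apply: uniq3 xy xz yz a b.
  have nxz : ~~ ((w \in far x) && (w \in far z)).
    by apply/negP => /andP[a b]; case/eqP: wy; apply: uniq3 xz xy _ a b; rewrite farC.
  have nyz : ~~ ((w \in far y) && (w \in far z)).
    apply/negP => /andP[a b]; case/eqP: wx; apply: uniq3 yz _ _ a b; by rewrite farC.
  (* The three far sets of a line cover all vertices, since (10 + 10 - 1) + 10 - 2 = 27. *)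
  have cov : w \in far x :|: far y :|: far z.
    suff -> : far x :|: far y :|: far z = setT by rewrite inE.
    apply/eqP; rewrite eqEcard subsetT cardsT cV.
    have I2 : (far x :|: far y) :&: far z = [set x; y].
      apply/setP => v; rewrite in_setI in_setU in_set2.
      apply/idP/idP => [/andP[/orP[vx|vy] vz]|].
      - by rewrite (uniq3 x z y v) ?eqxx ?orbT // farC.
      - by rewrite (uniq3 y z x v) ?eqxx // farC.
      - by case/orP => /eqP ->; rewrite ?[x \in far y]farC ?[x \in far z]farC
          ?[y \in far z]farC ?xy ?xz ?yz ?orbT.
    have := cardsUI (far x) (far y); have := cardsUI (far x :|: far y) (far z).
    rewrite I2 (third _ _ xy) !c_far cards2.
    have -> : x != y by move: xy; rewrite inE eq_sym => /andP[].
    by rewrite /=; lia.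
  move: cov nxy nxz nyz; rewrite !in_setU.
  by case: (w \in far x); case: (w \in far y); case: (w \in far z).
split=> //; apply: translational_local => // u v x uv ux dvx.
have xv : x \in far v.
  rewrite inE; apply/andP; split.
    by apply: contra_eq_neq dvx => ->; rewrite dist0.
  by rewrite -(dist_eq1 gG) dvx.
(* [c] completes the line through [v] and [x]. As [u] is adjacent to both, it is far from [c], and
   the third point of the line through [c] and [u] is the translate: both lines have sum 4 and share
   [c]. *)
have /eqP/cards1P[c Ec] := third _ _ xv.
have : c \in far v :&: far x by rewrite Ec inE.
rewrite inE => /andP[cv cx].
have cu : c \in far u.
  have := line _ _ _ u xv cv cx; rewrite (dist_adj gG uv) (dist_adj gG ux) => h.
  rewrite inE -(dist_eq1 gG); have -> : dist G u c = 2 by lia.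
  rewrite andbT; apply/negP => /eqP e; move: h; rewrite e dist0 //.
have /eqP/cards1P[y Ey] := third _ _ cu.
have : y \in far u :&: far c by rewrite Ey inE.
rewrite inE => /andP[yu yc]; exists y => w.
have := line _ _ _ w xv cv cx; have := line _ _ _ w cu yu yc; lia.
Qed.

(** * The Gosset graph *)

Lemma card_setI_sum (T : finType) (A B : {set T}) :
  #|A :&: B| = \sum_i ((i \in A) && (i \in B)).
Proof.
by rewrite -sum1_card big_mkcond /=; apply: eq_bigr => i _; rewrite inE; case: ifP.
Qed.

Section Gosset.
Notation J := (johnson 8 2).
Implicit Types (s : bool) (A B U V W X Y : vert J) (p q : vert gosset).

(** Two sheets, each a copy of [johnson 8 2]; the same pair in the other sheet is the antipode, at
    distance 3. *)
Definition gosset_dist p q : nat :=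
  if p.1 == q.1 then #|val p.2 :\: val q.2| else #|val p.2 :&: val q.2|.+1.

Lemma gosset_dist_pair s t A B : gosset_dist (s, A) (t, B) =
  if s == t then #|val A :\: val B| else #|val A :&: val B|.+1.
Proof. by []. Qed.

Lemma card_setID_johnson W A : #|val W :&: val A| + #|val W :\: val A| = 2.
Proof. by rewrite cardsID; apply: (@card_johnson 8 2 isT). Qed.

(** The distance is affine in the size [m] of the intersection, [2 - m] within a sheet and [1 + m]
    across; parallelism thus reduces to an identity between intersection sizes. *)
Lemma gosset_distE t W s A :
  gosset_dist (t, W) (s, A) + (t == s) * #|val W :&: val A| =
  if t == s then 2 else #|val W :&: val A|.+1.
Proof.
rewrite gosset_dist_pair; case: (t == s); last by rewrite mul0n addn0.
by rewrite mul1n addnC card_setID_johnson.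
Qed.

Lemma gosset_adj p q : adj gosset p q = (gosset_dist p q == 1).
Proof.
rewrite /adj /= /gosset_dist; case: (p.1 == q.1).
  exact: (@johnson_adj 8 2 isT p.2 q.2).
by rewrite -setI_eq0 -cards_eq0.
Qed.

Lemma gosset_distC p q : gosset_dist p q = gosset_dist q p.
Proof.
rewrite /gosset_dist eq_sym setIC; case: ifP => // _.
exact: (@johnson_setDC 8 2 isT).
Qed.

Lemma gosset_avoid A B : exists2 e, e \notin val A & e \notin val B.
Proof.
have : 0 < #|~: (val A :|: val B)|.
  have := cardsC (val A :|: val B); have := cardsUI (val A) (val B).
  rewrite !card_johnson // card_ord; lia.
by case/card_gt0P => e; rewrite !inE negb_or => /andP[eA eB]; exists e.
Qed.

Lemma connected_dist_gosset :
  simple_connected gosset /\ forall p q, dist gosset p q = gosset_dist p q.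
Proof.
have [[gJ _] dJ] := @tgraph_dist_johnson 8 2 isT.
apply: (@dist_unique gosset).
- split=> [p q|p]; first by rewrite !gosset_adj gosset_distC.
  by rewrite gosset_adj /gosset_dist eqxx setDv cards0.
- by move=> p; rewrite /gosset_dist eqxx setDv cards0.
- move=> [s A] [t B]; rewrite /gosset_dist /=; case: eqVneq => [->|//].
  by rewrite -dJ => /eqP; rewrite dist_eq0 // => /eqP ->.
- move=> [s W] [t B] [t' C]; rewrite gosset_adj /gosset_dist /=.
  have cW := @card_johnson 8 2 isT W.
  have cWC : #|val W :\: val C| <= 2.
    by rewrite -[X in _ <= X]cW; apply: subset_leq_card; rewrite subsetDl.
  case: (eqVneq t t') => [<-|tt'] /eqP c.
    case: ifP => _.
      apply: leq_trans (_ : #|(val W :\: val B) :|: (val B :\: val C)| <= _).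
        apply/subset_leq_card/subsetP => i; rewrite !inE.
        by case: (i \in val W); case: (i \in val B); case: (i \in val C).
      by apply: leq_trans (leq_card_setU _ _) _; rewrite c addn1.
    rewrite ltnS; have c' : #|val C :\: val B| = 1 by rewrite (@johnson_setDC 8 2 isT).
    apply: leq_trans (_ : #|(val W :&: val B) :|: (val C :\: val B)| <= _).
      apply/subset_leq_card/subsetP => i; rewrite !inE.
      by case: (i \in val W); case: (i \in val B); case: (i \in val C).
    by apply: leq_trans (leq_card_setU _ _) _; rewrite c' addn1.
  move: c => [/eqP]; rewrite cards_eq0 => /eqP d.
  case: (eqVneq s t) => [->|st]; last first.
    have -> : (s == t') by move: st tt'; case: (s); case: (t); case: (t').
    by apply: (leq_trans cWC).
  rewrite (negPf tt') ltnS; apply/subset_leq_card/subsetP => i.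
  rewrite !inE => /andP[-> iC]; rewrite andbT; apply/negP => iB.
  by have := in_set0 i; rewrite -d inE iB iC.
- move=> [s W] [t B] m; rewrite gosset_dist_pair; case: (eqVneq s t) => [<-|st] E.
    rewrite -dJ in E; have [C CB dC] := dist_pred gJ E; exists (s, C).
      by rewrite gosset_adj /gosset_dist eqxx -dJ dist_adj.
    by rewrite /gosset_dist eqxx -dJ.
  case: E => E; case: m E => [|m] E.
    exists (s, W); last by rewrite /gosset_dist eqxx setDv cards0.
    by rewrite gosset_adj /gosset_dist (negPf st) E.
  have /card_gt0P[a] : 0 < #|val W :&: val B| by rewrite E.
  rewrite inE => /andP[aW aB]; have [e eW eB] := gosset_avoid W B.
  have [C BC EC] := @johnson_exchange 8 2 isT _ _ _ aB eB.
  exists (t, C).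
    by rewrite gosset_adj /gosset_dist eqxx (@johnson_setDC 8 2 isT) -(@johnson_adj 8 2 isT).
  rewrite /gosset_dist (negPf st); congr _.+1.
  have -> : val W :&: val C = (val W :&: val B) :\ a.
    apply/setP => i; rewrite EC !inE; have [->|ne] := eqVneq i e.
      by rewrite (negPf eW) !andbF.
    by rewrite /= andbCA.
  by have := cardsD1 a (val W :&: val B); rewrite E inE aW aB add1n => -[].
Qed.

(** In one sheet the translate is that of [johnson 8 2]. With [x] alone in the other sheet it is
    [(U :|: X) :\: V] in the sheet of [x], and likewise for [v]; with [u] alone it is the complement
    of [U :|: V :|: X] in the sheet of [u]. *)
Lemma tgraph_gosset : tgraph gosset.
Proof.
have [gG dE] := connected_dist_gosset; have [[gJ tJ] dJ] := @tgraph_dist_johnson 8 2 isT.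
have adjE p q : adj gosset p q -> gosset_dist p q = 1 by rewrite gosset_adj => /eqP.
have mixed s (U V X : vert J) : #|val U :\: val V| = 1 -> #|val U :&: val X| = 0 ->
    #|val V :&: val X| = 1 -> exists y, forall w,
      gosset_dist w (~~ s, X) + gosset_dist w (s, V) =
      gosset_dist w (s, U) + gosset_dist w y.
  move=> UV UX VX.
  have cU := @card_johnson 8 2 isT U; have cV := @card_johnson 8 2 isT V.
  have cX := @card_johnson 8 2 isT X.
  have UX0 i : (i \in val U) && (i \in val X) = false.
    by move/eqP: UX; rewrite cards_eq0 => /eqP/setP/(_ i); rewrite !inE.
  have sV : val V \subset val U :|: val X.
    have VU : #|val V :\: val U| = 1 by rewrite (@johnson_setDC 8 2 isT).
    have E : val V :&: val X = val V :\: val U.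
      apply/eqP; rewrite eqEcard VX VU leqnn andbT; apply/subsetP => i.
      by have := UX0 i; rewrite !inE; case: (i \in val U); case: (i \in val X); case: (i \in val V).
    apply/subsetP => i iV; have /setP/(_ i) := E; rewrite !inE iV.
    by case: (i \in val U) => //= ->.
  have cY : #|(val U :|: val X) :\: val V| == 2.
    have := cardsUI (val U) (val X); rewrite UX cU cX => cUX.
    by have := cardsID (val V) (val U :|: val X); rewrite (setIidPr sV) cV; lia.
  pose Y : vert J := exist (fun D : {set 'I_8} => #|D| == 2) _ cY.
  suff HW b W : gosset_dist (b, W) (~~ s, X) + gosset_dist (b, W) (s, V) =
      gosset_dist (b, W) (s, U) + gosset_dist (b, W) (~~ s, Y).
    by exists (~~ s, Y) => -[b W]; apply: HW.
  have H : #|val W :&: val X| + #|val W :&: val U| =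
      #|val W :&: val V| + #|val W :&: val Y|.
    rewrite !card_setI_sum -!big_split /=; apply: eq_bigr => i _.
    have := UX0 i; have /implyP := subsetP sV i; rewrite !inE.
    by case: (i \in val U); case: (i \in val X); case: (i \in val V); case: (i \in val W).
  have := gosset_distE b W s U; have := gosset_distE b W s V.
  have := gosset_distE b W (~~ s) X; have := gosset_distE b W (~~ s) Y.
  by move: H; case: b; case: (s); rewrite /= ?mul1n ?mul0n; lia.
have same s (U V X : vert J) : #|val U :\: val V| = 1 -> #|val U :\: val X| = 1 ->
    #|val V :\: val X| = 2 -> exists y, forall w,
      gosset_dist w (s, X) + gosset_dist w (s, V) =
      gosset_dist w (s, U) + gosset_dist w y.
  move=> UV UX VX; rewrite -!dJ in UV UX VX.
  have [||Y HY] := tJ U V X; first by rewrite -dist_eq1 // UV.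
    by rewrite (distC gJ X) VX (distC gJ X) UX.
  suff HW b W : gosset_dist (b, W) (s, X) + gosset_dist (b, W) (s, V) =
      gosset_dist (b, W) (s, U) + gosset_dist (b, W) (s, Y).
    by exists (s, Y) => -[b W]; apply: HW.
  have := HY W; rewrite !dJ.
  have := gosset_distE b W s U; have := gosset_distE b W s V.
  have := gosset_distE b W s X; have := gosset_distE b W s Y.
  have := card_setID_johnson W U; have := card_setID_johnson W V.
  have := card_setID_johnson W X; have := card_setID_johnson W Y.
  by case: (b == s) => /=; rewrite ?mul1n ?mul0n; lia.
have opposite s t (U V X : vert J) : s != t -> #|val U :&: val V| = 0 ->
    #|val U :&: val X| = 0 -> #|val V :\: val X| = 2 -> exists y, forall w,
      gosset_dist w (t, X) + gosset_dist w (t, V) =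
      gosset_dist w (s, U) + gosset_dist w y.
  move=> st UV UX VX.
  have cU := @card_johnson 8 2 isT U; have cV := @card_johnson 8 2 isT V.
  have cX := @card_johnson 8 2 isT X.
  have VX0 : #|val V :&: val X| = 0.
    by have := card_setID_johnson V X; rewrite VX => /(@addIn 2 _ 0).
  have dis (A B : {set 'I_8}) i : #|A :&: B| = 0 -> (i \in A) && (i \in B) = false.
    by move/eqP; rewrite cards_eq0 => /eqP/setP/(_ i); rewrite !inE.
  have cY : #|~: (val U :|: val V :|: val X)| == 2.
    have := cardsC (val U :|: val V :|: val X); rewrite card_ord.
    have := cardsUI (val U) (val V); have := cardsUI (val U :|: val V) (val X).
    have -> : #|(val U :|: val V) :&: val X| = 0.
      apply/eqP; rewrite cards_eq0; apply/eqP/setP => i; rewrite !inE.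
      have := dis _ _ i UX; have := dis _ _ i VX0.
      by case: (i \in val U); case: (i \in val V); case: (i \in val X).
    by rewrite UV cU cV cX; lia.
  pose Y : vert J := exist (fun D : {set 'I_8} => #|D| == 2) _ cY.
  suff HW b W : gosset_dist (b, W) (t, X) + gosset_dist (b, W) (t, V) =
      gosset_dist (b, W) (s, U) + gosset_dist (b, W) (s, Y).
    by exists (s, Y) => -[b W]; apply: HW.
  have H : #|val W :&: val X| + #|val W :&: val V| +
      (#|val W :&: val U| + #|val W :&: val Y|) = 2.
    rewrite -[RHS](@card_johnson 8 2 isT W) -[in RHS](setIT (val W)) !card_setI_sum -!big_split /=.
    apply: eq_bigr => i _; rewrite !inE.
    have := dis _ _ i UX; have := dis _ _ i VX0; have := dis _ _ i UV.
    by case: (i \in val U); case: (i \in val V); case: (i \in val X); case: (i \in val W).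
  have := gosset_distE b W s U; have := gosset_distE b W s Y.
  have := gosset_distE b W t X; have := gosset_distE b W t V.
  by move: H st; case: b; case: (s); case: (t); rewrite //= ?mul1n ?mul0n; lia.
split=> //; apply: translational_local => // u v x uv ux dvx.
suff [y Hy] : exists y, forall w,
    gosset_dist w x + gosset_dist w v = gosset_dist w u + gosset_dist w y.
  by exists y => w; rewrite !dE.
move: dvx (adjE _ _ uv) (adjE _ _ ux); rewrite dE {uv ux}.
case: u v x => [s U] [t V] [t' X]; rewrite !gosset_dist_pair.
case: (eqVneq s t) => [<-|st]; case: (eqVneq s t') => [<-|st'].
- by move=> VX UV UX; apply: same.
- move=> -[VX] UV [UX].
  have -> : t' = ~~ s by move: st'; case: (s); case: (t').
  exact: mixed.
- rewrite eq_sym (negPf st) => -[XV] [UV] UX.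
  have -> : t = ~~ s by move: st; case: (s); case: (t).
  have [|y Hy] := mixed s U X V UX UV; first by rewrite setIC.
  by exists y => w; rewrite addnC Hy.
- have -> : t = t' by move: st st'; case: (s); case: (t); case: (t').
  by rewrite eqxx => VX [UV] [UX]; apply: opposite.
Qed.

End Gosset.

(** * Local graphs of the models *)

Definition local_at (H M : graph) (m : vert M) (f : vert H -> vert M) :=
  [/\ forall h, adj M m (f h), forall p, adj M m p -> exists h, f h = p,
      injective f & forall a b, adj M (f a) (f b) = adj H a b].

Lemma local_at_iso (H H' M : graph) (m : vert M) : iso H H' ->
  (exists f : vert H' -> vert M, local_at m f) -> exists f : vert H -> vert M, local_at m f.
Proof.
move=> [g [[g' gK g'K] gadj]] [f [f1 f2 f3 f4]]; exists (f \o g); split=> /=.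
- by move=> h; apply: f1.
- by move=> p /f2[h <-]; exists (g' h); rewrite /= g'K.
- exact: inj_comp f3 (can_inj gK).
- by move=> a b; rewrite f4.
Qed.

(** At an edge from [m] the count is a valency of the local graph; reflections along edges are
    automorphisms that carry it to every other vertex. *)
Lemma local_at_common (H M : graph) (m : vert M) (f : vert H -> vert M) (c : nat) :
  tgraph M -> local_at m f -> (forall h, #|adj H h| = c) ->
  forall u v, adj M u v -> common u v = c.
Proof.
move=> [gM tM] [f1 f2 f3 f4] reg.
have base v : adj M m v -> common m v = c.
  case/f2 => h <-; rewrite -(reg h) -(card_imset _ f3); apply: eq_card => z.
  rewrite inE; apply/andP/imsetP => [[/f2[a <-]]|[a ha ->]].
    by rewrite f4 => ha; exists a.
  by rewrite f1 f4.
pose P u := [forall v, adj M u v ==> (common u v == c)].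
suff H1 u : P u by move=> u v uv; have /forallP/(_ v)/implyP/(_ uv)/eqP := H1 u.
rewrite (@connected_const M bool P gM _ u m).
  by apply/forallP => v; apply/implyP => /base ->.
move=> a b ab; have [phi [[bij hom] inv e _ _] _] := translational_reflection gM tM ab.
have push x y : common (phi x) (phi y) = common x y.
  rewrite /common -[RHS](card_imset _ (bij_inj bij)); apply: eq_card => z.
  rewrite inE; apply/idP/imsetP => [|[w]].
    by rewrite -{1 2}[z]inv !hom => h; exists (phi z); rewrite ?inE ?inv.
  by rewrite inE => h ->; rewrite !hom.
apply/forallP/forallP => H1 v; apply/implyP => uv; move: (implyP (H1 (phi v))).
  have -> : adj M a (phi v) = adj M b v by rewrite -[LHS]hom e inv.
  have -> : common a (phi v) = common b v by rewrite -[LHS]push e inv.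
  by move/(_ uv).
by rewrite -{1 2}e hom push => /(_ uv).
Qed.

Lemma regular_card (H : graph) : tgraph H -> exists c, forall h : vert H, #|adj H h| = c.
Proof.
move=> [gH tH]; case: (pickP (@predT (vert H))) => [h0 _|H0]; last first.
  by exists 0 => h; have := H0 h.
exists (deg H h0) => h.
by rewrite -degE; apply: translational_regular.
Qed.

Lemma local_at_const (H M : graph) (m : vert M) (f : vert H -> vert M) :
  tgraph M -> tgraph H -> local_at m f -> exists c, forall u v, adj M u v -> common u v = c.
Proof.
move=> gM gH loc; have [c reg] := regular_card gH; exists c.
exact: local_at_common gM loc reg.
Qed.

Definition complete (G : graph) := forall x y : vert G, adj G x y = (x != y).

(** A neighbour of the set [M] is given by the element removed and the element added; two neighbours
    are adjacent when exactly one of these choices agrees. *)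
Lemma local_at_johnson (K1 K2 : graph) : complete K1 -> complete K2 -> 0 < #|vert K1| ->
  exists (m : vert (johnson (#|vert K1| + #|vert K2|) #|vert K1|))
    (f : vert (cart K1 K2) -> vert (johnson (#|vert K1| + #|vert K2|) #|vert K1|)),
  local_at m f.
Proof.
move=> c1 c2 a0; set a := #|vert K1| in a0 *; set b := #|vert K2|.
pose M := [set lshift b i | i : 'I_a].
have cM : #|M| == a by rewrite card_imset ?card_ord //; apply: lshift_inj.
pose l (y : vert K1) : 'I_(a + b) := lshift b (enum_rank y).
pose r (y : vert K2) : 'I_(a + b) := rshift a (enum_rank y).
have lM y : l y \in M by apply: imset_f.
have rM y : r y \notin M.
  by apply/imsetP => -[i _ /eqP]; rewrite /r eq_rlshift.
have linj : injective l by move=> y z /lshift_inj/enum_rank_inj.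
have rinj : injective r by move=> y z /rshift_inj/enum_rank_inj.
pose S (y : vert K1 * vert K2) := r y.2 |: (M :\ l y.1).
have cS y : #|S y| == a by rewrite card_exchange.
pose V (D : {set 'I_(a + b)}) (cD : #|D| == a) : vert (johnson (a + b) a) :=
  exist (fun D : {set 'I_(a + b)} => #|D| == a) D cD.
have mS k y : (k \in S y) = (k == r y.2) || (k != l y.1) && (k \in M).
  by rewrite !inE.
have lr y z : (l y == r z) = false by apply: contraNF (rM z) => /eqP <-.
have rl y z : (r y == l z) = false by rewrite eq_sym.
exists (V M cM), (fun y => V (S y) (cS y)); split.
- move=> y; rewrite johnson_adj //=; apply/cards1P; exists (l y.1); apply/setP => k.
  rewrite in_setD mS in_set1; have [->|ne] := eqVneq k (l y.1); first by rewrite lr lM.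
  by case: (k \in M); rewrite ?andbF //= orbT.
- move=> p /(johnson_nbr a0)[i [j [/imsetP[i' _ ->] jM Ep]]].
  case: (split_ordP j) jM Ep => j' -> jM Ep; first by rewrite imset_f in jM.
  exists (enum_val i', enum_val j'); apply: val_inj.
  by rewrite Ep /= /S /l /r /= !enum_valK.
- move=> y z /(congr1 val) /= E.
  have e1 : y.1 = z.1.
    apply/linj/eqP; have := mS (l y.1) z.
    by rewrite -E mS !lr eqxx /= lM andbT => /esym/negbFE.
  have e2 : y.2 = z.2.
    apply/rinj/eqP; have := mS (r y.2) z.
    by rewrite -E mS eqxx (negPf (rM _)) !andbF !orbF => /esym.
  by case: y z {E} e1 e2 => [y1 y2] [z1 z2] /= -> ->.
- move=> y z; rewrite johnson_adj //= c1 c2.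
  have D k : (k \in S y :\: S z) =
      (k == r y.2) && (y.2 != z.2) || (k == l z.1) && (y.1 != z.1).
    rewrite in_setD !mS; have [->|nr] := eqVneq k (r y.2).
      by rewrite !rl (inj_eq rinj) (negPf (rM _)) /= ?andbF ?orbF ?andbT ?orbF.
    have [->|nl] := eqVneq k (l z.1); first by rewrite lr lM (inj_eq linj) /= andbT eq_sym.
    by rewrite /=; case: (k \in M); rewrite ?andbF // !andbT orbT.
  have [e1|n1] := eqVneq y.1 z.1; have [e2|n2] := eqVneq y.2 z.2 => /=.
  + rewrite (_ : _ :\: _ = set0) ?cards0 //.
    by apply/setP => k; rewrite D e1 e2 !eqxx !andbF inE.
  + apply/cards1P; exists (r y.2); apply/setP => k.
    by rewrite D e1 eqxx n2 !andbF andbT orbF inE.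
  + apply/cards1P; exists (l z.1); apply/setP => k.
    by rewrite D e2 eqxx n1 andbF andbT inE.
  + rewrite (_ : _ :\: _ = [set r y.2; l z.1]); first by rewrite cards2 rl.
    by apply/setP => k; rewrite D n1 n2 !andbT !inE.
Qed.

Lemma local_at_cocktail k : exists (m : vert (cocktail k.+1))
  (f : vert (cocktail k) -> vert (cocktail k.+1)), local_at m f.
Proof.
exists (false, ord0), (fun p => (p.1, lift ord0 p.2)); split=> //.
- move=> [b i] /=; case: (unliftP ord0 i) => [j ->|->] // _.
  by exists (b, j).
- by move=> [b i] [c j] e; congr (_, _); [exact: (congr1 fst e) | exact: (lift_inj (congr1 snd e))].
Qed.

Lemma local_at_halved_cube n : exists (m : vert (halved_cube n))
  (f : vert (johnson n 2) -> vert (halved_cube n)), local_at m f.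
Proof.
have e0 : ~~ odd #|set0 : {set 'I_n}| by rewrite cards0.
pose m : vert (halved_cube n) := exist (fun D : {set 'I_n} => ~~ odd #|D|) _ e0.
have ev (A : vert (johnson n 2)) : ~~ odd #|val A| by rewrite (eqP (valP A)).
pose f (A : vert (johnson n 2)) : vert (halved_cube n) :=
  exist (fun D : {set 'I_n} => ~~ odd #|D|) _ (ev A).
have s0 (A : {set 'I_n}) : symdiff set0 A = A.
  by apply/setP => i; rewrite in_symdiff inE.
exists m, f; split.
- by move=> A; rewrite halved_cube_adj s0 (eqP (valP A)).
- move=> p; rewrite halved_cube_adj s0 => cp.
  by exists (exist (fun D : {set 'I_n} => #|D| == 2) _ cp); apply: val_inj.
- by move=> A B [] /val_inj.
- move=> A B; rewrite halved_cube_adj (@johnson_adj n 2 isT) card_symdiff.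
  by rewrite (@johnson_setDC n 2 isT B A) addnn -[2]/(1.*2) (inj_eq double_inj).
Qed.

Lemma johnson_compl n k : 0 < k < n -> iso (johnson n k) (johnson n (n - k)).
Proof.
move=> /andP[k0 kn]; have nk0 : 0 < n - k by rewrite subn_gt0.
have cC j (A : {set 'I_n}) : #|A| == j -> #|~: A| == n - j.
  by move=> /eqP <-; rewrite cardsCs card_ord setCK.
pose f (A : vert (johnson n k)) : vert (johnson n (n - k)) :=
  exist (fun D : {set 'I_n} => #|D| == n - k) _ (cC k _ (valP A)).
have cC' (A : vert (johnson n (n - k))) : #|~: val A| == k.
  by have := cC _ _ (valP A); rewrite subKn // ltnW.
pose g (A : vert (johnson n (n - k))) : vert (johnson n k) :=
  exist (fun D : {set 'I_n} => #|D| == k) _ (cC' A).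
exists f; split.
  by exists g => A; apply: val_inj; rewrite /= setCK.
move=> A B; rewrite !johnson_adj // (_ : _ :\: _ = val B :\: val A).
  by rewrite (johnson_setDC k0 B A).
by apply/setP => i; rewrite !inE negbK andbC.
Qed.

(** * The Schlafli graph as a local graph *)

(** Brings cardinalities to counts over lists of numbers, which [vm_compute] evaluates. *)
Lemma card_ord_count n (P : pred nat) : #|[set i : 'I_n | P i]| = count P (iota 0 n).
Proof.
rewrite cardsE cardE /enum_mem size_filter -enumT -val_enum_ord count_map.
by apply: eq_count.
Qed.

Lemma all_ord n (P : pred nat) : all P (iota 0 n) -> forall i : 'I_n, P i.
Proof. by move=> /allP H i; apply: H; rewrite mem_iota /=. Qed.

Lemma all_ord2 n (P : rel nat) : all (fun i => all (P i) (iota 0 n)) (iota 0 n) ->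
  forall i j : 'I_n, P i j.
Proof. by move=> H i j; apply: (all_ord (all_ord H i) j). Qed.

Definition pair_code := (bool * (nat * nat))%type.

Definition code_meet (x y : nat * nat) : nat :=
  (x.1 == y.1) + (x.1 == y.2) + (x.2 == y.1) + (x.2 == y.2).

Definition code_adj (x y : pair_code) : bool :=
  code_meet x.2 y.2 == if x.1 == y.1 then 1 else 0.

(* The neighbours of (false, {0, 1}) in the Gosset graph. *)
Definition schlafli_codes : seq pair_code := Eval compute in
  [seq x <- [seq (s, ij) | s <- [:: false; true],
                           ij <- [seq (i, j) | i <- iota 0 8, j <- iota 0 8]]
     | (x.2.1 < x.2.2) && code_adj (false, (0, 1)) x].

Definition schlafli_code (i : nat) : pair_code := nth (false, (0, 1)) schlafli_codes i.

Definition schlafli_graph : graph :=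
  @Graph 'I_27 (fun i j => code_adj (schlafli_code i) (schlafli_code j)).

Lemma schlafli_schlafli_graph : schlafli schlafli_graph.
Proof.
pose A i j := code_adj (schlafli_code i) (schlafli_code j).
have sA : forall i j : 'I_27, A i j == A j i.
  by apply: (all_ord2 (P := fun i j => A i j == A j i)); vm_compute.
have iA : forall i : 'I_27, ~~ A i i.
  by apply: (all_ord (P := fun i => ~~ A i i)); vm_compute.
have dA : forall i : 'I_27, count (A i) (iota 0 27) == 16.
  by apply: (all_ord (P := fun i => count (A i) (iota 0 27) == 16)); vm_compute.
pose c i j := count (fun k => A i k && A j k) (iota 0 27).
have cA : forall i j : 'I_27, (i == j :> nat) || (c i j == if A i j then 10 else 8).
  apply: (all_ord2 (P := fun i j => (i == j) || (c i j == if A i j then 10 else 8))).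
  by vm_compute.
have cE (x y : 'I_27) : #|[set z : 'I_27 | A x z && A y z]| = c x y.
  exact: (card_ord_count 27 (fun k => A x k && A y k)).
split; first split.
- move=> i j. exact: (eqP (sA i j)).
- by move=> i; apply/negbTE/iA.
- by rewrite card_ord.
- move=> x; rewrite degE -(eqP (dA x)) -card_ord_count cardsE; exact: eq_card.
- move=> x y /= xy; rewrite cE; have := cA x y; rewrite (_ : A x y) //.
  case/orP => [/eqP/val_inj e|/eqP //].
  by move: xy; rewrite e -/(A y y) (negPf (iA y)).
- move=> x y ne nxy; rewrite cE; have := cA x y.
  by rewrite (negPf (nxy : ~~ A x y)) val_eqE (negPf ne) => /eqP.
Qed.

(** Default of [insubd] in [code_vertex], not reached on valid codes; also a sample pair. *)
Definition gosset_pair0 : {A : {set 'I_8} | #|A| == 2} :=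
  exist _ [set ord0; ord_max] (introT eqP (cards2 ord0 ord_max)).

Definition code_set (x : nat * nat) : {set 'I_8} := [set inord x.1; inord x.2].

Definition code_vertex (x : pair_code) : vert gosset :=
  (x.1, insubd gosset_pair0 (code_set x.2)).

Definition code_valid (x : pair_code) := [&& x.2.1 < 8, x.2.2 < 8 & x.2.1 != x.2.2].

Lemma card_setI2 (T : finType) (a b : T) (D : {set T}) : a != b ->
  #|[set a; b] :&: D| = (a \in D) + (b \in D).
Proof.
move=> ab; rewrite (cardsD1 a) (cardsD1 b) !inE !eqxx orbT /= eq_sym ab /= (_ : _ :\ b = set0).
  by rewrite cards0 addn0.
by apply/setP => i; rewrite !inE; case: (i == a); case: (i == b).
Qed.

Lemma val_code_vertex x : code_valid x -> val (code_vertex x).2 = code_set x.2.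
Proof.
move=> /and3P[a b ne]; rewrite val_insubd /code_set cards2.
by rewrite -val_eqE /= !inordK // ne.
Qed.

Lemma card_code_setI x y : code_valid x -> code_valid y ->
  #|code_set x.2 :&: code_set y.2| = code_meet x.2 y.2.
Proof.
move=> /and3P[a b ne] /and3P[c d ne']; rewrite card_setI2.
  rewrite !inE -!val_eqE /= !inordK // /code_meet.
  case: x y a b ne c d ne' => [s [x1 x2]] [t [y1 y2]] /= _ _ ne _ _ ne'.
  have := eqVneq x1 y1; have := eqVneq x1 y2; have := eqVneq x2 y1; have := eqVneq x2 y2.
  by do 4 (case=> ?); subst; rewrite ?eqxx // in ne ne' *.
by rewrite -val_eqE /= !inordK.
Qed.

Lemma code_vertex_adj x y : code_valid x -> code_valid y ->
  adj gosset (code_vertex x) (code_vertex y) = code_adj x y.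
Proof.
move=> vx vy; rewrite /adj /= -/(code_vertex x).2 -/(code_vertex y).2.
rewrite -setI_eq0 -cards_eq0 (val_code_vertex vx) (val_code_vertex vy).
by rewrite card_code_setI // /code_adj; case: ifP.
Qed.

Lemma local_at_schlafli : exists (m : vert gosset) (f : vert schlafli_graph -> vert gosset),
  local_at m f.
Proof.
pose m0 : pair_code := (false, (0, 1)).
pose f (i : vert schlafli_graph) := code_vertex (schlafli_code (i : 'I_27)).
have valid : forall i : 'I_27, code_valid (schlafli_code i).
  by apply: (all_ord (P := fun i => code_valid (schlafli_code i))); vm_compute.
exists (code_vertex m0), f; split.
- move=> i; rewrite code_vertex_adj //; move: (i : 'I_27).
  by apply: (all_ord (P := fun i => code_adj m0 (schlafli_code i))); vm_compute.
- case=> s A; have /cards2P[c [d [cd EA]]] := valP A.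
  have vx : code_valid (s, (nat_of_ord c, nat_of_ord d)) by rewrite /code_valid /= !ltn_ord.
  have Es x : code_valid x -> x.1 = s -> code_set x.2 = [set c; d] -> code_vertex x = (s, A).
    move=> v <- e; rewrite [code_vertex x]surjective_pairing; congr (_, _).
    by apply: val_inj; rewrite val_code_vertex // e EA.
  have Ecd : code_set (nat_of_ord c, nat_of_ord d) = [set c; d].
    by rewrite /code_set /= !inord_val.
  rewrite -(Es _ vx erefl Ecd) code_vertex_adj // => a.
  (* The table lists each pair in increasing order only, so both orders are looked up. *)
  pose Q s (i j : nat) := (i != j) && code_adj m0 (s, (i, j)) ==>
    has (fun k => (schlafli_code k == (s, (i, j))) || (schlafli_code k == (s, (j, i))))
      (iota 0 27).
  have H : forall i j : 'I_8, Q s i j.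
    by apply: (all_ord2 (P := Q s)); case: (s); vm_compute.
  have := H c d; rewrite /Q a andbT => /implyP/(_ cd)/hasP[k].
  rewrite mem_iota /= => k27 Hk; exists (Ordinal k27 : 'I_27); rewrite (Es _ vx erefl Ecd).
  by apply: Es; [exact: (valid (Ordinal k27)) | |];
    case/orP: Hk => /eqP /= ->; rewrite // /code_set /= !inord_val // setUC.
- move=> i j e; apply/val_inj/eqP.
  have e1 := congr1 fst e; have := congr1 (fun p => val p.2) e.
  rewrite (val_code_vertex (valid i)) (val_code_vertex (valid j)) => e2.
  have := card_code_setI (valid i) (valid j); rewrite e2 setIid /code_set cards2.
  have /and3P[a b ne] := valid j; rewrite -val_eqE /= !inordK // ne /= => /esym/eqP h.
  pose Q (i j : nat) := ((schlafli_code i).1 == (schlafli_code j).1) &&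
    (code_meet (schlafli_code i).2 (schlafli_code j).2 == 2) ==> (i == j).
  have H : forall i j : 'I_27, Q i j by apply: (all_ord2 (P := Q)); vm_compute.
  by have := H i j; rewrite /Q h andbT => /implyP; apply; apply/eqP.
- by move=> i j; rewrite (code_vertex_adj (valid i) (valid j)).
Qed.

(** * Subsets as bit lists, and the halved cubes of dimension 4 and 5 *)

Section BitLists.
Variable n : nat.
Implicit Types (A B : {set 'I_n}) (l : seq bool).

Fixpoint bit_lists k : seq (seq bool) :=
  if k is k'.+1 then map (cons true) (bit_lists k') ++ map (cons false) (bit_lists k')
  else [:: [::]].

Lemma mem_bit_lists l : l \in bit_lists (size l).
Proof.
elim: l => //= b l IH; rewrite mem_cat.
by case: b; apply/orP; [left|right]; apply: map_f.
Qed.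

Definition bits A : seq bool := [seq i \in A | i <- enum 'I_n].

Definition bit_set l : {set 'I_n} := [set i | nth false l (val i)].

Definition weight l := count (nth false l) (iota 0 n).

Definition hamming l l' := count (fun i => nth false l i (+) nth false l' i) (iota 0 n).

Lemma bits_mem A : bits A \in bit_lists n.
Proof. by have := mem_bit_lists (bits A); rewrite size_map size_enum_ord. Qed.

Lemma nth_bits A (i : 'I_n) : nth false (bits A) i = (i \in A).
Proof. by rewrite (nth_map i) ?size_enum_ord // nth_ord_enum. Qed.

Lemma weight_bits A : weight (bits A) = #|A|.
Proof. by rewrite /weight -card_ord_count; apply: eq_card => i; rewrite inE nth_bits. Qed.

Lemma hamming_bits A B : hamming (bits A) (bits B) = #|symdiff A B|.
Proof.
rewrite /hamming -(card_ord_count n (fun i => nth false (bits A) i (+) nth false (bits B) i)).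
by apply: eq_card => i; rewrite inE !nth_bits in_symdiff.
Qed.

Lemma bits_bit_set l : size l = n -> bits (bit_set l) = l.
Proof.
move=> sl; apply: (@eq_from_nth _ false); rewrite size_map size_enum_ord // => i lt.
by rewrite (nth_bits _ (Ordinal lt)) inE.
Qed.

Lemma bits_inj : injective bits.
Proof. by move=> A B e; apply/setP => i; rewrite -!nth_bits e. Qed.

Lemma size_bit_lists k l : l \in bit_lists k -> size l = k.
Proof.
elim: k l => [|k IH] l /=; first by rewrite inE => /eqP ->.
by rewrite mem_cat => /orP[] /mapP[l' /IH <- ->].
Qed.

Definition even_lists := [seq l <- bit_lists n | ~~ odd (weight l)].

Lemma even_bits (A : vert (halved_cube n)) : bits (val A) \in even_lists.
Proof. by rewrite mem_filter bits_mem weight_bits (valP A). Qed.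

Lemma even_bits_onto l : l \in even_lists -> exists A : vert (halved_cube n), bits (val A) = l.
Proof.
rewrite mem_filter => /andP[e /size_bit_lists sl].
have eA : ~~ odd #|bit_set l| by rewrite -weight_bits bits_bit_set.
exists (exist (fun D : {set 'I_n} => ~~ odd #|D|) _ eA); exact: bits_bit_set.
Qed.

End BitLists.

Lemma local_at_halved_cube5 : exists (m : vert schlafli_graph)
  (f : vert (halved_cube 5) -> vert schlafli_graph), local_at m f.
Proof.
(* Vertex 0 has code [(false, (0, 2))]. Its 16 neighbours are {1, 2}, the five {0, k} with [k >= 3],
   and ten pairs from {3, ..., 7} in the other sheet; they match the empty set, the 4-sets by their
   missing element, and the 2-sets. *)
pose code (l : seq bool) : pair_code :=
  let P := [seq i <- iota 0 5 | nth false l i] in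
  match P with
  | [::] => (false, (1, 2))
  | [:: i; j] => (true, (i.+3, j.+3))
  | _ => (false, (0, (find negb l).+3))
  end.
pose g l := index (code l) schlafli_codes.
have all2 (P : rel (seq bool)) : all (fun l => all (P l) (even_lists 5)) (even_lists 5) ->
    forall A B : vert (halved_cube 5), P (bits (val A)) (bits (val B)).
  by move=> /allP H A B; have /allP := H _ (even_bits A); apply; apply: even_bits.
have g27 (A : vert (halved_cube 5)) : g (bits (val A)) < 27.
  by apply: (all2 (fun l _ => g l < 27) _ A A); vm_compute.
pose f (A : vert (halved_cube 5)) : vert schlafli_graph := Ordinal (g27 A).
exists (ord0 : 'I_27), f; split.
- move=> A; apply: (all2 (fun l _ => code_adj (schlafli_code 0) (schlafli_code (g l))) _ A A).
  by vm_compute.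
- move=> p a.
  pose Q (i : nat) := code_adj (schlafli_code 0) (schlafli_code i) ==>
    has (fun l => g l == i) (even_lists 5).
  have H : forall i : 'I_27, Q i by apply: all_ord; vm_compute.
  have /implyP/(_ a)/hasP[l /even_bits_onto[A <-] /eqP e] := H p.
  by exists A; apply: val_inj.
- move=> A B /(congr1 val) /= e; apply/val_inj/bits_inj/eqP.
  apply: (implyP (all2 (fun l l' => (g l == g l') ==> (l == l')) _ A B)); last exact/eqP.
  by vm_compute.
- move=> A B; rewrite halved_cube_adj -hamming_bits.
  have H := all2 (fun l l' => code_adj (schlafli_code (g l)) (schlafli_code (g l')) ==
    (hamming 5 l l' == 2)).
  by apply: (eqP (H _ A B)); vm_compute.
Qed.

Lemma halved_cube4_cocktail : iso (halved_cube 4) (cocktail 4).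
Proof.
(* Antipodal pairs are complementary sets, told apart by the first bit. [g] names the pair: 0 for
   weights 0 and 4, otherwise the other position that carries the same bit as position 0. *)
pose g (l : seq bool) : nat := if weight 4 l == 2 then (index (head false l) (behead l)).+1 else 0.
have all2 (P : rel (seq bool)) : all (fun l => all (P l) (even_lists 4)) (even_lists 4) ->
    forall A B : vert (halved_cube 4), P (bits (val A)) (bits (val B)).
  by move=> /allP H A B; have /allP := H _ (even_bits A); apply; apply: even_bits.
have g4 (A : vert (halved_cube 4)) : g (bits (val A)) < 4.
  by apply: (all2 (fun l _ => g l < 4) _ A A); vm_compute.
pose f (A : vert (halved_cube 4)) : vert (cocktail 4) :=
  (head false (bits (val A)), Ordinal (g4 A)).
have inj : injective f.
  move=> A B e; have e1 := congr1 fst e; have e2 := congr1 (fun p => val p.2) e.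
  rewrite /= in e1 e2; apply/val_inj/bits_inj/eqP.
  apply: (implyP (all2 (fun l l' => (head false l == head false l') && (g l == g l') ==>
    (l == l')) _ A B)); last by rewrite e1 e2 !eqxx.
  by vm_compute.
have onto (p : vert (cocktail 4)) : exists A, f A = p.
  case: p => b i.
  pose Q b (i : nat) := has (fun l => (head false l == b) && (g l == i)) (even_lists 4).
  have H : forall i : 'I_4, Q b i by apply: all_ord; case: (b); vm_compute.
  have /hasP[l /even_bits_onto[A <-] /andP[/eqP e1 /eqP e2]] := H i.
  by exists A; congr (_, _) => //; apply: val_inj.
have [h hK] := fin_all_exists onto.
exists f; split; first by exists h => // A; apply: inj; rewrite hK.
move=> A B; rewrite halved_cube_adj -hamming_bits.
have H := all2 (fun l l' => (g l != g l') == (hamming 4 l l' == 2)).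
by apply: (eqP (H _ A B)); vm_compute.
Qed.

(** * The list and its products *)

Lemma iso_refl (G : graph) : iso G G.
Proof. by exists id; split=> //; exists id. Qed.

Lemma iso_trans (G1 G2 G3 : graph) : iso G1 G2 -> iso G2 G3 -> iso G1 G3.
Proof.
move=> [f [bf af]] [g [bg ag]]; exists (g \o f); split; first exact: bij_comp.
by move=> x y; rewrite /= ag af.
Qed.

Lemma iso_sym (G1 G2 : graph) : iso G1 G2 -> iso G2 G1.
Proof.
move=> [f [[g fK gK] af]]; exists g; split; first by exists f.
by move=> x y; rewrite -af !gK.
Qed.

Lemma iso_common (G G' : graph) (f : vert G -> vert G') : bijective f ->
  (forall x y, adj G' (f x) (f y) = adj G x y) ->
  forall u v, common (f u) (f v) = common u v.
Proof.
move=> [g fK gK] af u v; rewrite /common -[RHS](card_imset _ (can_inj fK)).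
apply: eq_card => z; rewrite inE; apply/idP/imsetP => [h|[w]].
  by exists (g z); rewrite ?gK // inE -!af gK.
by rewrite inE => h ->; rewrite !af.
Qed.

Lemma schlafli_iso (G G' : graph) : iso G G' -> schlafli G' -> schlafli G.
Proof.
move=> [f [bf af]] [[sG iG] cV reg lam mu]; have injf := bij_inj bf.
split; first split.
- by move=> x y; rewrite -!af.
- by move=> x; rewrite -af.
- by rewrite -cV; exact: bij_eq_card bf.
- move=> x; rewrite -(reg (f x)) !degE -(card_imset _ injf); apply: eq_card => z.
  case: bf => g fK gK; apply/imsetP/idP => [[w h ->]|h].
    by rewrite /in_mem /= af.
  by exists (g z); rewrite ?gK // /in_mem /= -af gK.
- by move=> x y xy; have := iso_common bf af x y; rewrite /common => <-; apply: lam; rewrite af.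
- move=> x y ne xy; have := iso_common bf af x y; rewrite /common => <-.
  by apply: mu; rewrite ?af ?(inj_eq injf).
Qed.

(** Here the Schlafli graph is a fixed model: it has to be exhibited as a local graph of [gosset],
    which from the parameters alone would require their uniqueness theorem. *)
Definition basic_model (G : graph) :=
  (exists k, (2 <= k)%N /\ iso G (cocktail k)) \/
  (exists n k, (1 <= k < n)%N /\ iso G (johnson n k)) \/
  (exists n, (2 <= n)%N /\ iso G (halved_cube n)) \/
  iso G schlafli_graph \/
  iso G gosset.

(** Curvatures are left out so that the induction may form products freely; their equality is
    recovered in [basic_product_class]. *)
Inductive basic_product : graph -> Prop :=
| basic_product_base G : basic_model G -> basic_product G
| basic_product_cart G1 G2 G : basic_product G1 -> basic_product G2 -> iso G (cart G1 G2) -> basic_product G.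

Lemma basic_model_basic (G : graph) : basic_model G -> basic G.
Proof.
case=> [|[|[|[|]]]] h; [left|right;left|do 2 right;left|do 3 right;left|do 4 right] => //.
exact: schlafli_iso h schlafli_schlafli_graph.
Qed.

Lemma tgraph_johnson n k : 0 < k -> tgraph (johnson n k).
Proof. by move=> k0; case: (tgraph_dist_johnson n k0). Qed.

Lemma tgraph_halved_cube n : tgraph (halved_cube n).
Proof. by case: (tgraph_dist_halved_cube n). Qed.

Lemma tgraph_basic (G : graph) : basic G -> tgraph G.
Proof.
case=> [[k [k2 i]]|[[n [k [/andP[k0 _] i]]]|[[n [_ i]]|[h|i]]]].
- exact: tgraph_iso i (tgraph_cocktail k2).
- exact: tgraph_iso i (tgraph_johnson n k0).
- exact: tgraph_iso i (tgraph_halved_cube n).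
- exact: tgraph_srg.
- exact: tgraph_iso i tgraph_gosset.
Qed.

Lemma tgraph_basic_product (G : graph) : basic_product G -> tgraph G.
Proof.
elim=> {G} [G /basic_model_basic/tgraph_basic //|G1 G2 G _ g1 _ g2 i].
exact: tgraph_iso i (tgraph_cart g1 g2).
Qed.

Lemma basic_product_iso (G G' : graph) : iso G G' -> basic_product G' -> basic_product G.
Proof.
move=> i h; case: h i => {G'} [G' h|G1 G2 G' h1 h2 i'] i.
  apply: basic_product_base; case: h => [[k [k2 i']]|[[n [k [kn i']]]|[[n [n2 i']]|[i'|i']]]].
  - by left; exists k; split=> //; apply: iso_trans i'.
  - by right; left; exists n, k; split=> //; apply: iso_trans i'.
  - by do 2 right; left; exists n; split=> //; apply: iso_trans i'.
  - by do 3 right; left; apply: iso_trans i'.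
  - by do 4 right; apply: iso_trans i'.
exact: (basic_product_cart h1 h2 (iso_trans i i')).
Qed.

Definition complete_graph (T : finType) : graph := @Graph T (fun x y => x != y).

Lemma complete_complete_graph (T : finType) : complete (complete_graph T).
Proof. by []. Qed.

Lemma local_at_johnson_ord a b : 0 < a -> exists (m : vert (johnson (a + b) a))
  (f : vert (cart (complete_graph 'I_a) (complete_graph 'I_b)) -> vert (johnson (a + b) a)),
  local_at m f.
Proof.
move=> a0; have := local_at_johnson (@complete_complete_graph 'I_a) (@complete_complete_graph 'I_b).
by rewrite /= !card_ord => /(_ a0).
Qed.

Lemma basic_common (G : graph) : basic G ->
  exists c, forall u v : vert G, adj G u v -> common u v = c.
Proof.
have transfer (G' : graph) : iso G G' ->
    (exists c, forall u v : vert G', adj G' u v -> common u v = c) ->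
    exists c, forall u v : vert G, adj G u v -> common u v = c.
  move=> [f [bf af]] [c H]; exists c => u v uv.
  by rewrite -(iso_common bf af) H ?af.
case=> [[k [k2 i]]|[[n [k [/andP[k0 kn] i]]]|[[n [_ i]]|[h|i]]]].
- apply: transfer i _; case: k k2 => [//|[//|[|k]]] _.
    (* The 4-cycle is treated by hand: its local graph [cocktail 1] is disconnected, hence not a
       [tgraph]. *)
    exists 0 => u v uv; apply/eqP; rewrite cards_eq0; apply/eqP/setP => z.
    rewrite !inE /=; case: u v z uv => [a i] [b j] [c l] /=.
    by case: i j l => [[|[|//]] ?] [[|[|//]] ?] [[|[|//]] ?].
  have [m [f loc]] := local_at_cocktail k.+2.
  by apply: local_at_const loc; apply: tgraph_cocktail.
- apply: transfer i _; rewrite -(subnKC (ltnW kn)).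
  have [m [f loc]] := local_at_johnson_ord (n - k) k0.
  apply: local_at_const loc; first exact: tgraph_johnson.
  by apply: tgraph_cart; apply: tgraph_complete.
- apply: transfer i _; have [m [f loc]] := local_at_halved_cube n.
  by apply: local_at_const loc; [exact: tgraph_halved_cube|exact: tgraph_johnson].
- by exists 10 => u v uv; case: h => _ _ _ lam _; apply: lam.
- apply: transfer i _; have [m [f loc]] := local_at_schlafli.
  apply: local_at_const loc; first exact: tgraph_gosset.
  exact/tgraph_srg/schlafli_schlafli_graph.
Qed.

Lemma card_set_take (T : finType) (s : seq T) : uniq s -> #|[set x in s]| = size s.
Proof. by move=> us; rewrite cardsE; apply/card_uniqP. Qed.

Lemma johnson_vertex_exists n k : k <= n -> exists A : vert (johnson n k),
  val A = [set x in take k (enum 'I_n)].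
Proof.
move=> kn; have c : #|[set x in take k (enum 'I_n)]| == k.
  by rewrite card_set_take ?take_uniq ?enum_uniq // size_takel // size_enum_ord.
by exists (exist (fun D : {set 'I_n} => #|D| == k) _ c).
Qed.

Lemma basic_model_edge (G : graph) : basic_model G -> exists x y : vert G, adj G x y.
Proof.
have transfer (G' : graph) : iso G G' -> (exists x y : vert G', adj G' x y) ->
    exists x y : vert G, adj G x y.
  by move=> /iso_sym[f [bf af]] [x [y xy]]; exists (f x), (f y); rewrite af.
case=> [[k [k2 i]]|[[n [k [/andP[k0 kn] i]]]|[[n [n2 i]]|[i|i]]]]; apply: transfer i _.
- by exists (true, Ordinal (ltnW k2)), (true, Ordinal k2).
- have [A EA] := johnson_vertex_exists (ltnW kn); have cA := card_johnson k0 A.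
  have /card_gt0P[i iA] : 0 < #|val A| by rewrite cA.
  have /card_gt0P[j] : 0 < #|~: val A| by rewrite cardsCs setCK card_ord cA subn_gt0.
  rewrite inE => jA; have [B AB _] := johnson_exchange k0 iA jA; by exists A, B.
- have e0 : ~~ odd #|set0 : {set 'I_n}| by rewrite cards0.
  pose m : vert (halved_cube n) := exist (fun D : {set 'I_n} => ~~ odd #|D|) _ e0.
  have ij : Ordinal (ltnW n2) != Ordinal n2 by [].
  by have [B AB _] := halved_cube_flip m ij; exists m, B.
- by exists (Ordinal (isT : 0 < 27)), (Ordinal (isT : 1 < 27)); vm_compute.
- have [m [f [f1 _ _ _]]] := local_at_schlafli.
  by exists m, (f (Ordinal (isT : 0 < 27))).
Qed.

Lemma basic_product_edge (G : graph) : basic_product G -> exists x y : vert G, adj G x y.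
Proof.
elim=> {G} [G /basic_model_edge //|G1 G2 G _ [x [y xy]] _ [z _] /iso_sym[f [_ af]]].
by exists (f (x, z)), (f (y, z)); rewrite af /= xy eqxx orbT.
Qed.

(** * Small products are local graphs *)

Definition local_model (H : graph) := exists M (m : vert M) (f : vert H -> vert M),
  basic_product M /\ local_at m f.

Lemma local_model_iso (H H' : graph) : iso H H' -> local_model H' -> local_model H.
Proof.
move=> i [M [m [f [cM loc]]]].
have [f' loc'] := local_at_iso i (ex_intro _ f loc).
by exists M, m, f'.
Qed.

Definition diam2 (G : graph) := forall x y : vert G, dist G x y <= 2.

Lemma iso_dist (G G' : graph) (f : vert G -> vert G') : simple_connected G ->
  simple_connected G' -> bijective f ->
  (forall x y, adj G' (f x) (f y) = adj G x y) ->
  forall x y, dist G' (f x) (f y) = dist G x y.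
Proof.
move=> gG gG' [g fK gK] af.
case: (@dist_unique G (fun x y => dist G' (f x) (f y))) => //.
- by case: gG.
- by move=> x; rewrite dist0.
- by move=> x y /eqP; rewrite dist_eq0 // => /eqP/(can_inj fK).
- by move=> x y z yz; apply: dist_stepl => //; rewrite af.
- move=> x y n /(dist_pred gG')[z zy dz]; exists (g z); last by rewrite gK.
  by rewrite -af gK.
Qed.

Lemma diam2_iso (G G' : graph) : iso G G' -> tgraph G -> tgraph G' -> diam2 G -> diam2 G'.
Proof.
move=> [f [bf af]] [gG _] [gG' _] dG x y; case: (bf) => g _ gK.
by rewrite -[x]gK -[y]gK (iso_dist gG gG' bf af).
Qed.

Lemma complete_dist (G : graph) : simple_connected G ->
  (forall x y, dist G x y <= 1) -> complete G.
Proof.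
by move=> gG d1 x y; rewrite -(dist_eq1 gG) -(dist_eq0 gG); have := d1 x y; case: dist => [|[]].
Qed.

Lemma local_model_cart (K1 K2 : graph) : complete K1 -> complete K2 ->
  0 < #|vert K1| -> 0 < #|vert K2| -> local_model (cart K1 K2).
Proof.
move=> c1 c2 n1 n2; have [m [f loc]] := local_at_johnson c1 c2 n1.
exists _, m, f; split=> //; apply: basic_product_base; right; left.
exists (#|vert K1| + #|vert K2|), #|vert K1|; split; last exact: iso_refl.
by rewrite n1 -addn1 leq_add2l.
Qed.

Lemma local_model_complete (H : graph) : complete H -> 0 < #|vert H| -> local_model H.
Proof.
(* A complete graph is a product with a one-point graph, so it is local in some [johnson n 1]. *)
move=> cH nH; apply: (@local_model_iso _ (cart (complete_graph unit) H)).
  exists (fun x => (tt, x)); split; first by exists snd => // -[[] x].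
  by move=> x y /=; rewrite orbF.
by apply: local_model_cart; rewrite ?card_unit.
Qed.

Lemma local_model_johnson2 n : 2 <= n -> local_model (johnson n 2).
Proof.
move=> n2; have [m [f loc]] := local_at_halved_cube n.
exists _, m, f; split=> //; apply: basic_product_base; do 2 right; left.
by exists n; split=> //; exact: iso_refl.
Qed.

Lemma local_model_cocktail k : 2 <= k -> local_model (cocktail k).
Proof.
move=> k2; have [m [f loc]] := local_at_cocktail k.
exists _, m, f; split=> //; apply: basic_product_base; left.
by exists k.+1; split; [exact: ltnW | exact: iso_refl].
Qed.

Lemma johnson_diam n k : 3 <= k -> 3 <= n - k -> ~ diam2 (johnson n k).
Proof.
move=> k3 nk3 d2; have k0 : 0 < k by apply: leq_trans k3.
have [_ dJ] := tgraph_dist_johnson n k0.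
pose s := enum 'I_n; have us : uniq s := enum_uniq _.
have ss : size s = n by rewrite size_enum_ord.
have c (t : seq 'I_n) : uniq t -> size t = k -> #|[set x in t]| == k.
  by move=> ut <-; rewrite card_set_take.
have sA : size (take k s) = k by rewrite size_takel // ss; lia.
have sB : size (take k (drop 3 s)) = k by rewrite size_takel // size_drop ss; lia.
have cA := c _ (take_uniq k us) sA; have cB := c _ (take_uniq k (drop_uniq 3 us)) sB.
pose V (D : {set 'I_n}) (cD : #|D| == k) : vert (johnson n k) := exist (fun D : {set 'I_n} => #|D| == k) D cD.
have := d2 (V _ cA) (V _ cB); rewrite dJ /= leqNgt => /negP; apply.
apply: (@leq_trans #|[set x in take 3 s]|).
  by rewrite card_set_take ?take_uniq // size_takel // ss; lia.
apply/subset_leq_card/subsetP => x; rewrite !inE => x3.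
have xk : x \in take k s.
  by move: x3; rewrite -(take_takel s (j := k)) //; apply: mem_take.
rewrite xk andbT; apply/negP => /mem_take xd.
move: us; rewrite -(cat_take_drop 3 s) cat_uniq => /and3P[_ /hasPn/(_ x xd) /negP n3 _].
exact: n3.
Qed.

Lemma halved_cube_diam n : 6 <= n -> ~ diam2 (halved_cube n).
Proof.
move=> n6 d2; have [_ dH] := tgraph_dist_halved_cube n.
pose s := enum 'I_n; have us : uniq s := enum_uniq _.
have c6 : #|[set x in take 6 s]| = 6.
  by rewrite card_set_take ?take_uniq // size_takel // size_enum_ord.
have e6 : ~~ odd #|[set x in take 6 s]| by rewrite c6.
have e0 : ~~ odd #|set0 : {set 'I_n}| by rewrite cards0.
pose V (D : {set 'I_n}) (eD : ~~ odd #|D|) : vert (halved_cube n) :=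
  exist (fun D : {set 'I_n} => ~~ odd #|D|) D eD.
have := d2 (V _ e0) (V _ e6); rewrite dH /= /symdiff set0D set0U setD0.
by rewrite c6.
Qed.

Lemma gosset_diam : ~ diam2 gosset.
Proof.
move=> d2; have [_ dE] := connected_dist_gosset.
have := d2 (false, gosset_pair0) (true, gosset_pair0).
by rewrite dE gosset_dist_pair /= setIid cards2.
Qed.

(** Diameter 2 leaves the cocktail party graphs, [johnson n k] with [k] or [n - k] at most 2, the
    halved cubes with [n <= 5] and the Schlafli graph. Some of these are complete, and the halved
    4-cube is [cocktail 4]. *)
Lemma basic_model_local_model (H : graph) : basic_model H -> diam2 H -> local_model H.
Proof.
move=> cH dH; have gH := tgraph_basic (basic_model_basic cH).
case: cH => [[k [k2 i]]|[[n [k [/andP[k0 kn] i]]]|[[n [n2 i]]|[i|i]]]].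
- exact: local_model_iso i (local_model_cocktail k2).
- have dJ := diam2_iso i gH (tgraph_johnson n k0) dH; apply: local_model_iso i _.
  have [[gJ _] dE] := tgraph_dist_johnson n k0.
  have [A _] := johnson_vertex_exists (ltnW kn).
  have nJ : 0 < #|vert (johnson n k)| by apply/card_gt0P; exists A.
  have cJ := @card_johnson n k k0.
  have le_k (X Y : vert (johnson n k)) : dist (johnson n k) X Y <= k.
    by rewrite dE -[X in _ <= X](cJ X) subset_leq_card // subsetDl.
  have le_nk (X Y : vert (johnson n k)) : dist (johnson n k) X Y <= n - k.
    have cY : #|~: val Y| = n - k by rewrite cardsCs setCK card_ord cJ.
    by rewrite dE -cY; apply/subset_leq_card/subsetP => z; rewrite !inE => /andP[].
  have [k1|k1] := leqP k 1.
    by apply: local_model_complete => //; apply: complete_dist => // X Y; apply: leq_trans k1.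
  have [nk1|nk1] := leqP (n - k) 1.
    by apply: local_model_complete => //; apply: complete_dist => // X Y; apply: leq_trans nk1.
  have [k2|k2] := leqP k 2.
    have -> : k = 2 by lia.
    by apply: local_model_johnson2; lia.
  have [nk2|nk2] := leqP (n - k) 2; last by case: (johnson_diam k2 nk2).
  have knk : 0 < k < n by rewrite k0.
  apply: local_model_iso (johnson_compl knk) _.
  have -> : n - k = 2 by lia.
  by apply: local_model_johnson2; lia.
- have dJ := diam2_iso i gH (tgraph_halved_cube n) dH; apply: local_model_iso i _.
  have [[gJ _] dE] := tgraph_dist_halved_cube n.
  have [n3|n3] := leqP n 3.
    apply: local_model_complete.
      apply: complete_dist => // X Y; rewrite dE.
      have : #|symdiff (val X) (val Y)| <= n.
        by rewrite -[X in _ <= X]card_ord; apply: max_card.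
      move=> h; apply: (@leq_trans (3./2)) => //; apply: half_leq.
      exact: leq_trans h n3.
    have e0 : ~~ odd #|set0 : {set 'I_n}| by rewrite cards0.
    by apply/card_gt0P; exists (exist (fun D : {set 'I_n} => ~~ odd #|D|) _ e0).
  have [n5|n5] := leqP n 5; last by case: (halved_cube_diam n5).
  have /orP[/eqP->|/eqP ->] : (n == 4) || (n == 5) by lia.
    exact: local_model_iso halved_cube4_cocktail (local_model_cocktail _).
  have [m [f loc]] := local_at_halved_cube5.
  exists _, m, f; split=> //; apply: basic_product_base; do 3 right; left; exact: iso_refl.
- apply: local_model_iso i _; have [m [f loc]] := local_at_schlafli.
  exists _, m, f; split=> //; apply: basic_product_base; do 4 right; exact: iso_refl.
- by case: gosset_diam; apply: diam2_iso i gH tgraph_gosset dH.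
Qed.

(** Both factors of a product have an edge and diameters add, so diameter 2 makes both factors
    complete. *)
Lemma basic_product_local_model (H : graph) : basic_product H -> diam2 H -> local_model H.
Proof.
case=> {H} [H|G1 G2 H c1 c2 i] dH; first by move/basic_model_local_model; apply.
have g1 := tgraph_basic_product c1; have g2 := tgraph_basic_product c2.
have [gC dC] := tgraph_dist_cart g1 g2.
have dG := diam2_iso i (tgraph_iso i gC) gC dH.
have [x1 [y1 e1]] := basic_product_edge c1; have [x2 [y2 e2]] := basic_product_edge c2.
apply: local_model_iso i _; apply: local_model_cart.
- apply: (complete_dist g1.1) => x y; have := dG (x, x2) (y, y2).
  by rewrite dC /= (dist_adj g2.1 e2) addn1.
- apply: (complete_dist g2.1) => x y; have := dG (x1, x) (y1, y).
  by rewrite dC /= (dist_adj g1.1 e1) add1n.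
- by apply/card_gt0P; exists x1.
- by apply/card_gt0P; exists x2.
Qed.

(** * Classification *)

(** Like [local_at] for the subgraph induced on [A], but with [F] total on [G], so that maps on
    disjoint sets can be glued. *)
Definition local_on (G M : graph) (A : {set vert G}) (m : vert M) (F : vert G -> vert M) :=
  [/\ forall y, y \in A -> adj M m (F y),
      forall p, adj M m p -> exists2 y, y \in A & F y = p,
      {in A &, injective F} &
      {in A &, forall y z, adj M (F y) (F z) = adj G y z}].

Lemma local_on_induced (G : graph) (A : {set vert G}) : local_model (induced A) ->
  exists M (m : vert M) (F : vert G -> vert M), basic_product M /\ local_on A m F.
Proof.
move=> [M [m [f [cM [f1 f2 f3 f4]]]]].
pose F z := if (insub z : option {z | z \in A}) is Some u then f u else m.
have FE z (zA : z \in A) : F z = f (exist _ z zA) by rewrite /F insubT.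
exists M, m, F; split=> //; split.
- by move=> y yA; rewrite FE.
- by move=> p /f2[[y yA] <-]; exists y; rewrite ?FE.
- by move=> y z yA zA; rewrite !FE => /f3 [].
- by move=> y z yA zA; rewrite !FE f4.
Qed.

(** The neighbours of [(m1, m2)] in a product are those of [m1] and those of [m2], each in its own
    fibre, with no edges between the two kinds. *)
Lemma local_on_setU (G : graph) (A B : {set vert G}) :
  [disjoint A & B] -> (forall a b, a \in A -> b \in B -> adj G a b = false) ->
  (forall a b, a \in A -> b \in B -> adj G b a = false) ->
  (exists M (m : vert M) (F : vert G -> vert M), basic_product M /\ local_on A m F) ->
  (exists M (m : vert M) (F : vert G -> vert M), basic_product M /\ local_on B m F) ->
  exists M (m : vert M) (F : vert G -> vert M), basic_product M /\ local_on (A :|: B) m F.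
Proof.
move=> dAB nAB nBA [M1 [m1 [F1 [c1 [a1 o1 i1 e1]]]]] [M2 [m2 [F2 [c2 [a2 o2 i2 e2]]]]].
have [g1 _] := tgraph_basic_product c1; have [g2 _] := tgraph_basic_product c2.
have BA z : z \in B -> (z \in A) = false by move=> zB; rewrite (disjointFl dAB zB).
pose F z : vert (cart M1 M2) := if z \in A then (F1 z, m2) else (m1, F2 z).
have FA z : z \in A -> F z = (F1 z, m2) by rewrite /F => ->.
have FB z : z \in B -> F z = (m1, F2 z) by rewrite /F => /BA ->.
have n1 y : y \in A -> (m1 == F1 y) = false by move=> /a1/(adj_neq g1)/negbTE.
have n2 y : y \in B -> (m2 == F2 y) = false by move=> /a2/(adj_neq g2)/negbTE.
exists (cart M1 M2), (m1, m2), F; split.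
  exact: (basic_product_cart c1 c2 (iso_refl _)).
split.
- move=> y /setUP[yA|yB]; first by rewrite FA //= a1 // eqxx orbT.
  by rewrite FB //= a2 // eqxx.
- move=> [p q] /= /orP[/andP[/eqP <- /o2[y yB <-]]|/andP[/o1[y yA <-] /eqP <-]].
    by exists y; rewrite ?FB // inE yB orbT.
  by exists y; rewrite ?FA // inE yA.
- move=> y z /setUP[yA|yB] /setUP[zA|zB].
  + by rewrite !FA // => /(congr1 fst); apply: i1.
  + by rewrite (FA _ yA) (FB _ zB) => /(congr1 fst) /= /esym/eqP; rewrite n1.
  + by rewrite (FB _ yB) (FA _ zA) => /(congr1 fst) /= /eqP; rewrite n1.
  + by rewrite !FB // => /(congr1 snd); apply: i2.
- move=> y z /setUP[yA|yB] /setUP[zA|zB].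
  + by rewrite !FA //= e1 // eqxx adj_irr // andbF andbT.
  + by rewrite (FA _ yA) (FB _ zB) /= [F1 y == _]eq_sym n1 // n2 // andbF nAB.
  + by rewrite (FB _ yB) (FA _ zA) /= n1 // [F2 y == _]eq_sym n2 // andbF nBA.
  + by rewrite !FB //= e2 // eqxx adj_irr // orbF.
Qed.

Lemma basic_product_of_tgraph n (G : graph) : #|vert G| <= n -> tgraph G ->
  (exists x y : vert G, adj G x y) -> basic_product G.
Proof.
elim: n G => [|n IH] G cG gG [x [y0 xy0]].
  by have := max_card (pred1 x); rewrite card1; move: cG; case: #|_|.
have [sG tG] := gG.
have step (A : {set vert G}) : (exists y, y \in A) -> (forall y, y \in A -> adj G x y) ->
    (forall a b, a \in A -> adj G x b -> adj G a b -> b \in A) ->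
    exists M (m : vert M) (F : vert G -> vert M), basic_product M /\ local_on A m F.
  (* [A] is a union of components of the local graph; one component [C] is split off at a time. *)
  move Ek: #|A| => k; elim/ltn_ind: k A Ek => k IHk A Ek [y yA] AN Acl.
  have xy := AN y yA; set C := local_component x y.
  have yC : y \in C by rewrite inE xy /near eqxx.
  have Ccl := local_component_step sG tG xy.
  have CN c : c \in C -> adj G x c by rewrite inE => /andP[].
  have sCA : C \subset A.
    apply/subsetP => z; rewrite inE => /andP[xz]; rewrite /near.
    case/or3P => [/eqP <- //|yz|/existsP[p /and3P[xp yp pz]]]; first exact: Acl yz.
    by apply: (Acl p) => //; apply: Acl yp.
  have modelC : exists M (m : vert M) (F : vert G -> vert M), basic_product M /\ local_on C m F.
    apply: local_on_induced; have gC : tgraph (induced C) := tgraph_local_component sG tG xy.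
    have dC : diam2 (induced C).
      move=> a b; have := local_component_diam sG tG xy a b.
      case/or3P => [/eqP ->|ab|/existsP[p /andP[ap pb]]]; first by rewrite (dist0 gC.1).
        by rewrite (dist_adj gC.1 ab).
      by have := dist_triangle gC.1 p a b; rewrite (dist_adj gC.1 ap) (dist_adj gC.1 pb).
    (* The induction hypothesis asks for an edge. A component without one is a single vertex, hence
       complete. *)
    case: (pickP (fun p : vert (induced C) * vert (induced C) => adj _ p.1 p.2)) => [[a b] ab|no].
      apply: basic_product_local_model => //; apply: IH => //; last by exists a, b.
      rewrite /= card_sig -ltnS; apply: leq_trans cG; rewrite -cardsT.
      apply/proper_card/properP; split; first exact/subsetP.
      by exists x; rewrite !inE ?adj_irr.
    apply: local_model_complete; last by apply/card_gt0P; exists (exist _ y yC).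
    apply: (complete_dist gC.1) => a b; case E: (dist _ a b) => [|d] //.
    by have [z zb _] := dist_pred gC.1 E; have := no (z, b); rewrite zb.
  have [AC|] := eqVneq (A :\: C) set0.
    have -> : A = C by apply/eqP; rewrite eqEsubset sCA andbT -setD_eq0 AC.
    exact: modelC.
  case/set0Pn => z zAC; rewrite -(setID A C) (setIidPr sCA).
  have cross c d : c \in C -> d \in A :\: C -> adj G c d = false.
    move=> cC /setDP[dA dC]; apply: contraNF dC => cd.
    by apply: (Ccl c) => //; apply: AN.
  apply: local_on_setU => //.
  - by rewrite disjoints_subset; apply/subsetP => w wC; rewrite in_setC in_setD wC.
  - by move=> c d cC dA; rewrite adjC // cross.
  - apply: (IHk #|A :\: C|) => //.
    + rewrite -Ek; apply/proper_card/properP; split; first exact: subsetDl.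
      by exists y; rewrite // in_setD yC.
    + by exists z.
    + by move=> w /setDP[/AN].
    + move=> a b aAC xb ab; have /setDP[aA aC] := aAC; rewrite in_setD (Acl a) // andbT.
      by apply: contraL ab => bC; rewrite adjC // cross.
have [M [m [F [cM [F1 F2 F3 F4]]]]] : exists M (m : vert M) (F : vert G -> vert M),
    basic_product M /\ local_on [set y | adj G x y] m F.
  apply: step; first by exists y0; rewrite inE.
    by move=> y; rewrite inE.
  by move=> a b _ xb _; rewrite inE.
have [gM tM] := tgraph_basic_product cM.
apply: basic_product_iso cM; apply: (@local_iso G M sG tG gM tM x m F).
- by move=> y xy; apply: F1; rewrite inE.
- by move=> p /F2[y]; rewrite inE; exists y.
- by move=> y z xy xz; apply: F3; rewrite inE.
- by move=> y z xy xz; apply: F4; rewrite inE.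
Qed.

(** A common neighbour of two adjacent vertices in one fibre must lie in that fibre. *)
Lemma common_cart (G1 G2 : graph) (a b : vert G1) (c d : vert G2) :
  simple_connected G1 -> simple_connected G2 ->
  (adj G1 a b -> common ((a, c) : vert (cart G1 G2)) (b, c) = common a b) /\
  (adj G2 c d -> common ((a, c) : vert (cart G1 G2)) (a, d) = common c d).
Proof.
move=> g1 g2; split=> e.
  have inj : injective (fun z : vert G1 => (z, c)) by move=> x y [].
  rewrite /common -[RHS](card_imset _ inj); apply: eq_card => -[z w].
  rewrite inE /=; apply/idP/imsetP => [|[v + [-> ->]]].
    have [->|zc] := eqVneq c w; rewrite ?andbF ?andbT ?orbF ?adj_irr //= ?andbF /=.
      by move=> h; exists z; rewrite ?inE.
    case/andP => /andP[/eqP <- _] /andP[/eqP h _].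
    by move: e; rewrite h adj_irr.
  by rewrite inE eqxx => /andP[-> ->]; rewrite !orbT.
have inj : injective (fun z : vert G2 => (a, z)) by move=> x y [].
rewrite /common -[RHS](card_imset _ inj); apply: eq_card => -[z w].
rewrite inE /=; apply/idP/imsetP => [|[v + [-> ->]]].
  have [->|za] := eqVneq a z; rewrite ?adj_irr //= ?orbF.
    by move=> h; exists w; rewrite ?inE.
  case/andP => /andP[_ /eqP <-] /andP[_ /eqP h].
  by move: e; rewrite h adj_irr.
by rewrite inE eqxx => /andP[-> ->].
Qed.

Lemma tgraph_ocurv (R : realType) (G : graph) (u v : vert G) : tgraph G -> adj G u v ->
  ocurv G R u v = ((common u v).+2%:R)%R.
Proof.
move=> [gG tG] uv; have [phi r _] := translational_reflection gG tG uv.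
exact: (reflection_ocurv R gG uv r).
Qed.

(** By [common_cart] the constant [t] of the product is inherited by each factor, so all graphs at
    the leaves have the same curvature [t + 2]. *)
Lemma basic_product_class (R : realType) (G : graph) (t : nat) : basic_product G ->
  (forall u v : vert G, adj G u v -> common u v = t) -> prod_class (t.+2%:R : R)%R G.
Proof.
move=> c; elim: c => {G} [G h|G1 G2 G c1 IH1 c2 IH2 i] ct.
  have bG := basic_model_basic h; apply: pc_base => // u v uv.
  by rewrite (tgraph_ocurv _ (tgraph_basic bG) uv) ct.
have [g1 _] := tgraph_basic_product c1; have [g2 _] := tgraph_basic_product c2.
have [x1 _] := basic_product_edge c1; have [x2 _] := basic_product_edge c2.
have /iso_sym[f [bf af]] := i.
apply: pc_prod i; [apply: IH1 => u v uv | apply: IH2 => u v uv].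
  rewrite -((common_cart u v x2 x2 g1 g2).1 uv) -(iso_common bf af) ct // af /= uv eqxx.
  by rewrite orbT.
rewrite -((common_cart x1 x1 u v g1 g2).2 uv) -(iso_common bf af) ct // af /= uv eqxx.
by [].
Qed.

Lemma prod_class_const (R : realType) (G : graph) (k : R) : prod_class k G ->
  tgraph G /\ const_curv G R k.
Proof.
elim=> {G} [G bG ck|G1 G2 G _ [g1 k1] _ [g2 k2] i].
  by split=> //; apply: tgraph_basic.
have gG := tgraph_iso i (tgraph_cart g1 g2); split=> // u v uv.
have [f [bf af]] := i.
rewrite tgraph_ocurv // -(iso_common bf af); move: uv; rewrite -af.
case: (f u) (f v) => [a c] [b d] /= /orP[/andP[/eqP <- cd]|/andP[ab /eqP <-]].
  by rewrite (common_cart a a c d g1.1 g2.1).2 // -(k2 _ _ cd) tgraph_ocurv.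
by rewrite (common_cart a b c c g1.1 g2.1).1 // -(k1 _ _ ab) tgraph_ocurv.
Qed.

Theorem theorem4p2 (R : realType) (G : graph) :
  simple_graph G -> connected G -> (exists x y : vert G, adj G x y) ->
  (eff_BM_sharp G R <-> (reflective G /\ exists k : R, const_curv G R k)) /\
  ((reflective G /\ exists k : R, const_curv G R k) <-> class_iii R G).
Proof.
move=> sG cG eG; have gG : simple_connected G by [].
split; split.
- move=> sh; split; last exact: sharp_const_curv.
  exact: translational_reflective gG (sharp_translational gG sh).
- move=> [rG [k ck]]; exact: translational_sharp gG (reflective_translational gG rG) k eG ck.
- move=> [rG [k ck]]; right; have G' : tgraph G by split=> //; exact: reflective_translational.
  have [x [y xy]] := eG; exists ((common x y).+2%:R)%R; apply: basic_product_class.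
    exact: basic_product_of_tgraph (leqnn _) G' eG.
  move=> u v uv; apply/eqP; rewrite -2!eqSS -(eqr_nat R) -!tgraph_ocurv //.
  by rewrite !ck.
- case=> [bG|[k /prod_class_const[[_ tG] ck]]]; last first.
    by split; [exact: translational_reflective | exists k].
  have G' := tgraph_basic bG; split; first by apply: translational_reflective => //; case: G'.
  (* The first alternative of [class_iii] carries no curvature; constancy comes from the list
     itself. *)
  have [c cE] := basic_common bG; exists (c.+2%:R)%R => u v uv.
  by rewrite tgraph_ocurv // cE.
Qed.
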